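(* Let $\mathcal{C}$ be a class of graphs of bounded genus (i.e. there is $g \in \mathbb{N}$ such that every graph in $\mathcal{C}$ has Euler genus at most $g$) and let $\mathsf{T}$ be a (first-order) transduction. Then there exist a class $\mathcal{D}$ of graphs that has slice decompositions and a number $k \in \mathbb{N}$ such that every graph in $\mathsf{T}(\mathcal{C})$ is a $k$-flip of a graph from $\mathcal{D}$.
   Context: All graphs are finite, simple, undirected and loopless, and are viewed as structures over one binary predicate $E$; colored graphs are graphs additionally equipped with finitely many unary predicates. Graphs are considered up to isomorphism. Interpretation: a first-order formula $\psi(x,y)$ in the language of (colored) graphs is an interpretation formula if it is antireflexive and symmetric, i.e. for all (colored) graphs $G$ and $u,v\in V(G)$ we have $G\not\models\psi(u,u)$ and $G\models\psi(u,v)\Leftrightarrow G\models\psi(v,u)$. For such $\psi$, $\psi(G)$ is the graph with vertex set $V(G)$ and edge set $\{uv \mid G\models\psi(u,v)\}$. Transduction: a transduction $\mathsf{T}$ is given by a number $m$ and an interpretation formula $\psi(x,y)$ which may use $m$ unary predicates. $\mathsf{T}(G)$ is the set of all graphs obtained from $G$ by (i) marking the vertices of $G$ with at most $m$ unary predicates in an arbitrary fashion, obtaining $G^+$, (ii) forming $\psi(G^+)$, and (iii) taking an induced subgraph of $\psi(G^+)$. For a class $\mathcal{C}$, $\mathsf{T}(\mathcal{C}) = \bigcup_{G\in\mathcal{C}}\mathsf{T}(G)$. Slice decomposition: let $f:\mathbb{N}\to\mathbb{N}$ and let $G$ be a graph. A slice decomposition of $G$ guarded by $f$ is a partition $V_1,\dots,V_\ell$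 of $V(G)$ such that (i) if $uv\in E(G)$, then $u\in V_i$ and $v\in V_j$ with $|i-j|\le 1$; (ii) for every $k\in\mathbb{N}$ and every $i\le \ell-k+1$, the clique-width of $G[V_i\cup\dots\cup V_{i+k-1}]$ is at most $f(k)$. A class $\mathcal{D}$ has slice decompositions if there is a single function $f:\mathbb{N}\to\mathbb{N}$ such that every $G\in\mathcal{D}$ has a slice decomposition guarded by $f$. Flip: a graph $H$ is a $k$-flip of a graph $G$ if $H$ can be obtained from $G$ by partitioning $V(G)$ into at most $k$ parts and complementing the adjacency between some pairs of (not necessarily distinct) parts. *)

(* Defs.v *)
From HB Require Import structures.
From mathcomp Require Import all_boot all_order all_algebra all_fingroup.

Set Implicit Arguments.
Unset Strict Implicit.
Unset Printing Implicit Defensive.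

(** * Graphs and graph classes *)

Record graph := Graph {
  vertex :> finType;
  edge : rel vertex;
  edge_sym : symmetric edge;
  edge_irrefl : irreflexive edge }.

Arguments edge : clear implicits.

Definition iso (G H : graph) : Prop :=
  exists2 f : G -> H, bijective f & {mono f : u v / edge G u v >-> edge H u v}.

Lemma iso_sym G H : iso G H -> iso H G.
Proof.
case=> f [g fK gK] fE; exists g; first by exists f.
by move=> u v; rewrite -fE !gK.
Qed.

Lemma iso_trans G H K : iso G H -> iso H K -> iso G K.
Proof.
case=> f fB fE [g gB gE]; exists (g \o f); first exact: bij_comp.
by move=> u v; rewrite /= gE fE.
Qed.

(* Graphs are considered up to isomorphism, so classes are iso-closed. *)
Record graph_class := GraphClass {
  in_class :> graph -> Prop;
  class_iso : forall G H, iso G H -> in_class G -> in_class H }.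

Section Induced.
Variables (G : graph) (A : {set G}).

Definition induced_edge : rel {x : G | x \in A} :=
  fun u v => edge G (val u) (val v).

Lemma induced_edge_sym : symmetric induced_edge.
Proof. by move=> u v; apply: edge_sym. Qed.

Lemma induced_edge_irrefl : irreflexive induced_edge.
Proof. by move=> u; apply: edge_irrefl. Qed.

Definition induced : graph := Graph induced_edge_sym induced_edge_irrefl.
End Induced.

(** * First-order logic on colored graphs *)

(* [formula m n]: well-scoped formulas over the edge predicate, equality and
   [m] unary predicates, with free variables among [n] variables.  Variable 0
   of the body of [FEx] is the one it binds. *)
Inductive formula (m : nat) : nat -> Type :=
| FBot n : formula m n
| FEq n (i j : 'I_n) : formula m n
| FEdge n (i j : 'I_n) : formula m n
| FColor n (c : 'I_m) (i : 'I_n) : formula m n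
| FImp n (phi psi : formula m n) : formula m n
| FEx n (phi : formula m n.+1) : formula m n.

(* The unary predicates may overlap and may be empty. *)
Definition coloring (m : nat) (G : graph) := 'I_m -> {set G}.

Fixpoint sat (m : nat) (G : graph) (col : coloring m G) (n : nat)
    (phi : formula m n) : n.-tuple G -> bool :=
  match phi with
  | FBot _ => fun=> false
  | FEq _ i j => fun e => tnth e i == tnth e j
  | FEdge _ i j => fun e => edge G (tnth e i) (tnth e j)
  | FColor _ c i => fun e => tnth e i \in col c
  | FImp _ p q => fun e => sat col p e ==> sat col q e
  | FEx _ p => fun e => [exists v : G, sat col p [tuple of v :: e]]
  end.

Definition sat2 (m : nat) (G : graph) (col : coloring m G)
  (psi : formula m 2) : rel G := fun u v => sat col psi [tuple u; v].

(** * Transductions *)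

Definition interpretation_formula (m : nat) (psi : formula m 2) : Prop :=
  forall (G : graph) (col : coloring m G),
    irreflexive (sat2 col psi) /\ symmetric (sat2 col psi).

Record transduction := Transduction {
  num_colors : nat;
  tr_formula : formula num_colors 2;
  tr_interp : interpretation_formula tr_formula }.

Definition interpret (T : transduction) (G : graph)
    (col : coloring (num_colors T) G) : graph :=
  Graph (@tr_interp T G col).2 (@tr_interp T G col).1.

Definition transduces (T : transduction) (G H : graph) : Prop :=
  exists (col : coloring (num_colors T) G) (A : {set interpret col}),
    iso H (induced A).

Definition image_mem (T : transduction) (C : graph_class) (H : graph) : Prop :=
  exists2 G, C G & transduces T G H.

Lemma image_mem_iso T C G H : iso G H -> image_mem T C G -> image_mem T C H.
Proof.
move=> isoGH [G0 CG0 [col [A isoA]]]; exists G0 => //; exists col, A.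
exact: iso_trans (iso_sym isoGH) isoA.
Qed.

Definition transduction_image (T : transduction) (C : graph_class) :
  graph_class := GraphClass (@image_mem_iso T C).

(** * Euler genus, via embedding schemes *)

(* By the Heffter-Edmonds-Ringel principle, cellular embeddings of a connected
   graph into closed (orientable or not) surfaces are the same as embedding
   schemes: a cyclic order of the darts (oriented edges) leaving each vertex,
   and a signature telling which edges are twisted. *)

Definition dart (G : graph) := {p : G * G | edge G p.1 p.2}.

Definition source (G : graph) (d : dart G) : G := (val d).1.

Lemma dart_rev_subproof (G : graph) (d : dart G) :
  edge G (val d).2 (val d).1.
Proof. by rewrite edge_sym (valP d). Qed.

Definition dart_rev (G : graph) (d : dart G) : dart G :=
  exist (fun p : G * G => edge G p.1 p.2)
    ((val d).2, (val d).1) (dart_rev_subproof d).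

Record embedding_scheme (G : graph) := EmbeddingScheme {
  rotation : {perm dart G};
  rotation_cyclic : forall d d',
    (d' \in porbit rotation d) = (source d' == source d);
  twisted : pred (dart G);
  twisted_rev : forall d, twisted (dart_rev d) = twisted d }.

Section SchemeGenus.
Variables (G : graph) (S : embedding_scheme G).

(* Face traversal: walk along a dart, then turn to the next edge around its
   head, in the order of the rotation or in the opposite order according to
   the boolean, which is switched whenever a twisted edge is traversed. *)
Definition face_step (x : dart G * bool) : dart G * bool :=
  let flipped := x.2 (+) twisted S x.1 in
  let next := if flipped then (rotation S)^-1%g else rotation S in
  (next (dart_rev x.1), flipped).

Definition num_edges : nat := #|{: dart G}|./2.

Definition num_isolated : nat := #|[pred v : G | [forall w, ~~ edge G v w]]|.

(* Every face is traversed by exactly two orbits of [face_step], one in each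
   direction; a component reduced to a vertex has a single face. *)
Definition num_faces : nat := (fcard face_step predT)./2 + num_isolated.

Definition num_components : nat := n_comp (edge G) predT.

(* Sum over the connected components of 2 - (V - E + F). *)
Definition scheme_euler_genus : int :=
  (2 * num_components%:Z
   - (#|{: G}|%:Z - num_edges%:Z + num_faces%:Z))%R.
End SchemeGenus.

(* The Euler genus of a graph is the minimum over its embedding schemes. *)
Definition euler_genus_at_most (g : nat) (G : graph) : Prop :=
  exists S : embedding_scheme G, (scheme_euler_genus S <= g%:Z)%R.

Definition bounded_genus (C : graph_class) : Prop :=
  exists g : nat, forall G, C G -> euler_genus_at_most g G.

(** * Clique-width *)

Record lgraph (k : nat) := LGraph {
  lgraph_graph :> graph;
  label : lgraph_graph -> 'I_k }.

Section CliqueWidthOperations.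
Variable k : nat.
Implicit Types L M : lgraph k.

Definition vert_edge : rel unit := fun _ _ => false.

Lemma vert_edge_sym : symmetric vert_edge. Proof. by []. Qed.

Lemma vert_edge_irrefl : irreflexive vert_edge. Proof. by []. Qed.

Definition lg_vert (i : 'I_k) : lgraph k :=
  @LGraph k (Graph vert_edge_sym vert_edge_irrefl) (fun=> i).

Definition union_edge L M : rel (L + M)%type := fun u v =>
  match u, v with
  | inl x, inl y => edge L x y
  | inr x, inr y => edge M x y
  | _, _ => false
  end.

Lemma union_edge_sym L M : symmetric (@union_edge L M).
Proof. by move=> [x|x] [y|y] //=; apply: edge_sym. Qed.

Lemma union_edge_irrefl L M : irreflexive (@union_edge L M).
Proof. by move=> [x|x] /=; apply: edge_irrefl. Qed.

Definition lg_union L M : lgraph k :=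
  @LGraph k (Graph (@union_edge_sym L M) (@union_edge_irrefl L M))
    (fun u => match u with inl x => label x | inr y => label y end).

Definition lg_relabel (i j : 'I_k) L : lgraph k :=
  @LGraph k L (fun x => if label x == i then j else label x).

Definition join_edge (i j : 'I_k) L : rel L := fun x y =>
  [|| edge L x y, (label x == i) && (label y == j)
    | (label x == j) && (label y == i)].

Lemma join_edge_sym i j L : symmetric (@join_edge i j L).
Proof.
move=> x y; rewrite /join_edge edge_sym; congr (_ || _).
by rewrite orbC andbC [X in _ || X]andbC.
Qed.

Lemma join_edge_irrefl i j L : i != j -> irreflexive (@join_edge i j L).
Proof.
move=> ij x; rewrite /join_edge edge_irrefl /=.
by case: eqP => [->|_]; rewrite ?(negPf ij) ?andbF.
Qed.

Definition lg_join (i j : 'I_k) (ij : i != j) L : lgraph k :=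
  @LGraph k (Graph (@join_edge_sym i j L) (join_edge_irrefl ij)) (@label k L).

Inductive cw_expr : Type :=
| CWVert (i : 'I_k)
| CWUnion (e1 e2 : cw_expr)
| CWRelabel (i j : 'I_k) (e : cw_expr)
| CWJoin (i j : 'I_k) (ij : i != j) (e : cw_expr).

Fixpoint cw_eval (e : cw_expr) : lgraph k :=
  match e with
  | CWVert i => lg_vert i
  | CWUnion e1 e2 => lg_union (cw_eval e1) (cw_eval e2)
  | CWRelabel i j e => lg_relabel i j (cw_eval e)
  | CWJoin i j ij e => lg_join ij (cw_eval e)
  end.
End CliqueWidthOperations.

(* The empty graph, which no expression denotes, has clique-width 0. *)
Definition cliquewidth_at_most (k : nat) (G : graph) : Prop :=
  #|{: G}| = 0 \/ exists e : cw_expr k, iso (cw_eval e) G.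

(** * Slice decompositions *)

(* The parts are numbered from 0. *)
Definition slice_decomposition (f : nat -> nat) (G : graph)
    (V : seq {set G}) : Prop :=
  [/\ uniq V /\ partition [set A in V] [set: G],
      forall (u v : G) (i j : nat), edge G u v ->
        u \in nth set0 V i -> v \in nth set0 V j -> i <= j.+1 /\ j <= i.+1
    & forall k i : nat, i + k <= size V ->
        cliquewidth_at_most (f k)
          (induced (\bigcup_(A <- take k (drop i V)) A))].

Definition has_slice_decompositions (D : graph_class) : Prop :=
  exists f : nat -> nat, forall G, D G ->
    exists V : seq {set G}, slice_decomposition f V.

(** * Flips *)

Section Flip.
Variables (G : graph) (P : {set {set G}}) (F : {set {set {set G}}}).

(* [P] is the partition; [F] holds the pairs of parts to be complemented, as
   unordered pairs [[set A; B]], a part paired with itself being [[set A]]. *)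
Definition flip_edge : rel G := fun u v =>
  (u != v) && (edge G u v (+) ([set pblock P u; pblock P v] \in F)).

Lemma flip_edge_sym : symmetric flip_edge.
Proof. by move=> u v; rewrite /flip_edge eq_sym edge_sym setUC. Qed.

Lemma flip_edge_irrefl : irreflexive flip_edge.
Proof. by move=> u; rewrite /flip_edge eqxx. Qed.

Definition flip : graph := Graph flip_edge_sym flip_edge_irrefl.
End Flip.

Definition is_flip (k : nat) (G H : graph) : Prop :=
  exists (P : {set {set G}}) (F : {set {set {set G}}}),
    [/\ partition P [set: G], #|P| <= k & iso H (flip P F)].

(* Main.v *)
Require Import Defs.
From HB Require Import structures.
From mathcomp Require Import all_boot all_order all_algebra all_fingroup.
From mathcomp Require Import zify.

(* A graph of Euler genus g has a breadth-first layering in which every union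
   of boundedly many layers has bounded clique-width: take a BFS tree T of the
   graph and a spanning tree of the dual graph that avoids T; only O(g) edges
   are left over, and each subtree of the dual tree is separated from the rest
   by O(g) paths of T, which meet each layer at most once.

   By Gaifman locality, whether a first-order formula psi(u, v) holds for two
   vertices in distant layers only depends on the local types of u and v.
   Flipping between the classes of equal local type therefore removes all edges
   of psi(G) between distant layers, and blocks of consecutive layers become
   slices. Inside boundedly many layers, truth of psi(u, v) is again decided by
   a game of bounded length and radius, and the game composes along the
   recursive decomposition of these layers, so the clique-width stays bounded. *)

Set Implicit Arguments.
Unset Strict Implicit.
Unset Printing Implicit Defensive.

(** * Back-and-forth games *)

(** Both sides of a game lie in one colored graph. Sentences then agree trivially, and Gaifman's
    theorem becomes a comparison of local types, without any normal form. Locality is proved for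
    every pseudometric in which edges have length at most 1, and is used for the difference of
    layers instead of the graph distance: balls are then unions of consecutive layers, whose
    decompositions are known.

    The surface may be non-orientable, so faces have no global orientation; flags treat both
    traversals of a face alike. Faces may be long, so the dual tree has unbounded degree, and a
    vertex lies on many faces. Each face is therefore unrolled into a path of flags that starts
    where the face is entered from its parent, and each non-isolated vertex is housed at one of its
    flags; a flag then has at most four children.

    Small separators do not survive an interpretation. What survives is a bound on the number of
    distinct adjacency rows across a cut: a small separator implies such a bound, and a row of
    psi(G) is determined by a type from a finite set. *)

Section Game.
Variables (X C B : finType) (chi : X -> C) (beta : X -> X -> B) (nu : pred B).
Implicit Types (p : seq (X * X)) (q : nat).

Definition consistent p : bool :=
  all (fun a => (chi a.1 == chi a.2)
    && all (fun b => beta a.1 b.1 == beta a.2 b.2) p) p.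

(* A move must be [nu]-related to an earlier element of its side; the answer
   then is as well, by consistency. *)
Fixpoint ef q p : bool :=
  if q is q'.+1 then
    [&& ef q' p,
      [forall y, has (fun a => nu (beta a.1 y)) p
        ==> [exists y', ef q' ((y, y') :: p)]]
    & [forall y', has (fun a => nu (beta a.2 y')) p
        ==> [exists y, ef q' ((y, y') :: p)]]]
  else consistent p.

Lemma consistentP p :
  reflect ({in p, forall a, chi a.1 = chi a.2}
           /\ {in p &, forall a b, beta a.1 b.1 = beta a.2 b.2})
    (consistent p).
Proof.
apply: (iffP allP) => [H|[H1 H2] a ap].
  split=> [a /H /andP[/eqP //]|a b /H /andP[_ /allP Ha] /Ha /eqP //].
by rewrite H1 // eqxx /=; apply/allP => b bp; rewrite H2.
Qed.

Lemma efSP q p :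
  reflect [/\ ef q p,
      forall y a, a \in p -> nu (beta a.1 y) -> exists y', ef q ((y, y') :: p)
    & forall y' a, a \in p -> nu (beta a.2 y') -> exists y, ef q ((y, y') :: p)]
    (ef q.+1 p).
Proof.
apply: (iffP and3P) => -[H0 H1 H2]; split=> //.
- by move=> y a ap ny; apply/existsP; apply: (implyP (forallP H1 y)); apply/hasP; exists a.
- by move=> y a ap ny; apply/existsP; apply: (implyP (forallP H2 y)); apply/hasP; exists a.
- by apply/forallP => y; apply/implyP => /hasP[a ap ny]; apply/existsP; apply: H1 ap ny.
- by apply/forallP => y; apply/implyP => /hasP[a ap ny]; apply/existsP; apply: H2 ap ny.
Qed.

Lemma ef_le q q' p : q' <= q -> ef q p -> ef q' p.
Proof.
elim: q => [|q IH]; first by rewrite leqn0 => /eqP->.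
by rewrite leq_eqVlt => /orP[/eqP-> //|/IH{}IH /efSP[/IH]].
Qed.

Lemma ef_consistent q p : ef q p -> consistent p.
Proof. exact: (@ef_le q 0). Qed.

Lemma ef_sub q p p' : {subset p' <= p} -> ef q p -> ef q p'.
Proof.
elim: q p p' => [|q IH] p p' sub.
  move=> /consistentP[H1 H2]; apply/consistentP; split.
    by move=> a /sub/H1.
  by move=> a b /sub ap /sub; apply: H2.
have sub2 a : {subset a :: p' <= a :: p}.
  by move=> b; rewrite !inE => /orP[->//|/sub->]; rewrite orbT.
case/efSP=> H0 H1 H2; apply/efSP; split; first exact: IH H0.
  by move=> y a /sub/H1 H /H[y' e]; exists y'; apply: IH e.
by move=> y a /sub/H2 H /H[y' e]; exists y'; apply: IH e.
Qed.

Lemma ef_refl q p : {in p, forall a, a.1 = a.2} -> ef q p.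
Proof.
elim: q p => [|q IH] p H.
  by apply/consistentP; split=> [a /H->//|a b /H-> /H->].
apply/efSP; split; first exact: IH.
- by move=> y a _ _; exists y; apply: IH => b; rewrite inE => /orP[/eqP->//|/H].
- by move=> y a _ _; exists y; apply: IH => b; rewrite inE => /orP[/eqP->//|/H].
Qed.

Lemma ef_sym q p : ef q p -> ef q [seq (a.2, a.1) | a <- p].
Proof.
elim: q p => [|q IH] p.
  move=> /consistentP[H1 H2]; apply/consistentP; split.
    by move=> _ /mapP[a /H1 ap ->].
  by move=> _ _ /mapP[a ap ->] /mapP[b bp ->] /=; rewrite H2.
case/efSP=> H0 H1 H2; apply/efSP; split; first exact: IH.
- by move=> y _ /mapP[a ap ->] /= /(H2 _ _ ap)[z /IH e]; exists z.
- by move=> y _ /mapP[a ap ->] /= /(H1 _ _ ap)[z /IH e]; exists z.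
Qed.

Lemma ef_trans q (t : seq (X * X * X)) :
  ef q [seq (a.1.1, a.1.2) | a <- t] -> ef q [seq (a.1.2, a.2) | a <- t] ->
  ef q [seq (a.1.1, a.2) | a <- t].
Proof.
elim: q t => [|q IH] t.
  move=> /consistentP[H1 H2] /consistentP[K1 K2]; apply/consistentP; split.
    move=> _ /mapP[a at_ ->] /=.
    by rewrite (H1 _ (map_f _ at_)) (K1 _ (map_f _ at_)).
  move=> _ _ /mapP[a at_ ->] /mapP[b bt ->] /=.
  by rewrite (H2 _ _ (map_f _ at_) (map_f _ bt)) (K2 _ _ (map_f _ at_) (map_f _ bt)).
move=> H K; have [H0 H1 H2] := efSP _ _ H; have [K0 K1 K2] := efSP _ _ K.
apply/efSP; split; first exact: IH.
- move=> y _ /mapP[a at_ ->] /= ny.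
  have [y' e'] := H1 y _ (map_f _ at_) ny.
  have [_ c] := consistentP _ (ef_consistent e').
  have ny' : nu (beta a.1.2 y').
    rewrite -(c (a.1.1, a.1.2) (y, y')) ?inE ?eqxx //=.
    by rewrite (map_f (fun a => (a.1.1, a.1.2)) at_) orbT.
  have [y'' e''] := K1 y' _ (map_f _ at_) ny'.
  by exists y''; apply: (IH (((y, y'), y'') :: t)).
- move=> y _ /mapP[a at_ ->] /= ny.
  have [y' e'] := K2 y _ (map_f _ at_) ny.
  have [_ c] := consistentP _ (ef_consistent e').
  have ny' : nu (beta a.1.2 y').
    rewrite (c (a.1.2, a.2) (y', y)) ?inE ?eqxx //=.
    by rewrite (map_f (fun a => (a.1.2, a.2)) at_) orbT.
  have [y'' e''] := H2 y' _ (map_f _ at_) ny'.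
  by exists y''; apply: (IH (((y'', y'), y) :: t)).
Qed.
End Game.

(** Coarser invariants and fewer legal moves for Spoiler only help Duplicator. *)
Lemma ef_weaken (X C B C' B' : finType) (chi : X -> C) (beta : X -> X -> B)
    (nu : pred B) (chi' : X -> C') (beta' : X -> X -> B') (nu' : pred B') q p :
    (forall x y, chi x = chi y -> chi' x = chi' y) ->
    (forall x y z t, beta x y = beta z t -> beta' x y = beta' z t) ->
    (forall x y, nu' (beta' x y) -> nu (beta x y)) ->
  ef chi beta nu q p -> ef chi' beta' nu' q p.
Proof.
move=> Hc Hb Hn; elim: q p => [|q IH] p.
  move=> /consistentP[H1 H2]; apply/consistentP; split.
    by move=> a /H1/Hc.
  by move=> a b ap bp; apply: Hb; apply: H2.
case/efSP=> H0 H1 H2; apply/efSP; split; first exact: IH.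
- by move=> y a ap /Hn/(H1 y a ap)[z /IH e]; exists z.
- by move=> y a ap /Hn/(H2 y a ap)[z /IH e]; exists z.
Qed.

(** * Types of bounded rank *)

Section Types.
Variables (C B : finType).

(** Hintikka types: the atomic type of a tuple, then repeatedly the set of types of its legal
    extensions. They do not depend on the structure [X], so their number is bounded uniformly over
    all graphs; parts of flips and clique-width labels are counted by it. *)
Fixpoint game_type (q n : nat) : finType :=
  if q is q'.+1 then (game_type q' n * {set game_type q' n.+1})%type
  else ({ffun 'I_n -> C} * {ffun 'I_n * 'I_n -> B})%type.

Variables (X : finType) (chi : X -> C) (beta : X -> X -> B) (nu : pred B).

Fixpoint type_of (q n : nat) : n.-tuple X -> game_type q n :=
  match q with
  | 0 => fun s => ([ffun i => chi (tnth s i)],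
                   [ffun ij => beta (tnth s ij.1) (tnth s ij.2)])
  | q'.+1 => fun s => (type_of q' s,
      [set type_of q' [tuple of y :: s]
         | y in [pred y | has (fun x => nu (beta x y)) s]])
  end.

Lemma type_of_ef q n (s s' : n.-tuple X) :
  type_of q s = type_of q s' -> ef chi beta nu q (zip s s').
Proof.
elim: q n s s' => [|q IH] n s s' /=.
  case=> /ffunP Hc /ffunP Hb; apply/consistentP.
  have memP a : a \in zip s s' -> exists i, a = (tnth s i, tnth s' i).
    case: a => x y /(nthP (x, y))[i]; rewrite size_zip !size_tuple minnn => ltin <-.
    exists (Ordinal ltin); rewrite nth_zip ?size_tuple //.
    by rewrite (tnth_nth x) (tnth_nth y).
  split=> [a /memP[i ->]|a b /memP[i ->] /memP[j ->]] /=.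
    by have := Hc i; rewrite !ffunE.
  by have := Hb (i, j); rewrite !ffunE.
case=> H0 /setP H1; apply/efSP; split; first exact: IH.
- move=> y a as_ ny; have := H1 (type_of q [tuple of y :: s]).
  case: imsetP => [_ /esym/imsetP[y' _ /IH e]|[]]; first by exists y'.
  exists y => //; rewrite inE; apply/hasP; exists a.1 => //.
  by have := map_f fst as_; rewrite -/unzip1 unzip1_zip // !size_tuple.
- move=> y a as_ ny; have := H1 (type_of q [tuple of y :: s']).
  case: imsetP => [[y' _ e] _|_ /esym/imsetP[]].
    by exists y'; apply: (IH _ [tuple of y' :: s] [tuple of y :: s'] (esym e)).
  exists y => //; rewrite inE; apply/hasP; exists a.2 => //.
  by have := map_f snd as_; rewrite -/unzip2 unzip2_zip // !size_tuple.
Qed.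
End Types.

(** * Gaifman locality *)

(** Only a pseudometric: distinct vertices may be at distance 0, as are two vertices of one layer
    for [layer_dist]. *)
Definition edge_metric (G : graph) (d : G -> G -> nat) : Prop :=
  [/\ forall x, d x x = 0, forall x y, d x y = d y x,
      forall x y z, d x z <= d x y + d y z
    & forall x y, edge G x y -> d x y <= 1].

Section LocalGame.
Variables (m : nat) (G : graph) (col : coloring m G) (d : G -> G -> nat).

Definition colors_of (x : G) : {set 'I_m} := [set c | x \in col c].

(** Capping distances at r+1 keeps the set of values finite and still decides every threshold up to
    r. *)
Definition local_rel (r : nat) (x y : G) : bool * bool * 'I_r.+2 :=
  (x == y, edge G x y, inord (minn (d x y) r.+1)).

Definition local_near (r : nat) : pred (bool * bool * 'I_r.+2) :=
  fun b => b.2 <= r.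

Definition local_ef (q r : nat) : seq (G * G) -> bool :=
  ef colors_of (local_rel r) (@local_near r) q.

Lemma local_nearE r x y : local_near (local_rel r x y) = (d x y <= r).
Proof. by rewrite /local_near /= inordK; lia. Qed.

Lemma local_relP r x y x' y' :
  (local_rel r x y == local_rel r x' y')
  = [&& (x == y) == (x' == y'), edge G x y == edge G x' y'
      & minn (d x y) r.+1 == minn (d x' y') r.+1].
Proof.
rewrite /local_rel !xpair_eqE -andbA; congr [&& _, _ & _].
by rewrite -val_eqE /= !inordK //; lia.
Qed.

Lemma local_ef_le q r q' r' p :
  q' <= q -> r' <= r -> local_ef q r p -> local_ef q' r' p.
Proof.
move=> leq ler /(ef_le leq); apply: ef_weaken => // [x y z t|x y].
  move/eqP; rewrite local_relP => /and3P[/eqP e1 /eqP e2 /eqP e3].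
  by apply/eqP; rewrite local_relP e1 e2 !eqxx /=; lia.
by rewrite !local_nearE; lia.
Qed.

Lemma local_ef_pair q r p a b : local_ef q r p -> a \in p -> b \in p ->
  [/\ (a.1 == b.1) = (a.2 == b.2), edge G a.1 b.1 = edge G a.2 b.2
    & forall s, s <= r -> (d a.1 b.1 <= s) = (d a.2 b.2 <= s)].
Proof.
move=> /ef_consistent/consistentP[_ H] ap bp.
have /eqP := H a b ap bp; rewrite local_relP => /and3P[/eqP-> /eqP-> /eqP e].
by split=> // s; move: (d _ _) (d _ _) e => u v; lia.
Qed.

Lemma local_ef_move q r p a y : local_ef q.+1 r p -> a \in p ->
  d a.1 y <= r -> exists y', local_ef q r ((y, y') :: p).
Proof. by move=> /efSP[_ + _] ap le; apply; [exact: ap|rewrite local_nearE]. Qed.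

Lemma local_ef_comove q r p a y' : local_ef q.+1 r p -> a \in p ->
  d a.2 y' <= r -> exists y, local_ef q r ((y, y') :: p).
Proof. by move=> /efSP[_ _ +] ap le; apply; [exact: ap|rewrite local_nearE]. Qed.

Hypothesis dP : edge_metric d.

Let d0 x : d x x = 0. Proof. by case: dP. Qed.
Let dC x y : d x y = d y x. Proof. by case: dP. Qed.
Let dT x y z : d x z <= d x y + d y z. Proof. by case: dP => _ _ ->. Qed.
Let dE x y : edge G x y -> d x y <= 1. Proof. by case: dP => _ _ _; apply. Qed.

(* Each of the q remaining moves of radius r brings the two sides closer to
   each other by at most 2r. *)
Lemma local_ef_cat q r p1 p2 : 0 < r -> local_ef q r p1 -> local_ef q r p2 ->
  (forall a b, a \in p1 -> b \in p2 ->
     q.*2.+1 * r < d a.1 b.1 /\ q.*2.+1 * r < d a.2 b.2) ->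
  local_ef q r (p1 ++ p2).
Proof.
move=> r0; elim: q p1 p2 => [|q IH] p1 p2.
  move=> /consistentP[c1 b1] /consistentP[c2 b2] far; apply/consistentP; split.
    by move=> a; rewrite mem_cat => /orP[/c1|/c2].
  have cross x y x' y' : r < d x y -> r < d x' y' ->
      local_rel r x y = local_rel r x' y'.
    move=> f f'; apply/eqP; rewrite local_relP.
    have ne u v : r < d u v -> (u == v) = false.
      by move=> h; apply: contraTF h => /eqP->; rewrite d0.
    have ned u v : r < d u v -> edge G u v = false.
      by move=> h; apply: contraTF h => /dE; lia.
    by rewrite !ne ?ned //=; lia.
  move=> a b; rewrite !mem_cat => /orP[ap|ap] /orP[bp|bp];
    [exact: b1| | |exact: b2].
  + by have [] := far _ _ ap bp; rewrite mul1n; apply: cross.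
  + by have [] := far _ _ bp ap; rewrite mul1n (dC b.1) (dC b.2); apply: cross.
move=> e1 e2.
have -> : q.+1.*2.+1 * r = q.*2.+1 * r + r.*2 by nia.
move: IH; set K := q.*2.+1 * r => IH far.
have [e1' e2'] := (ef_le (leqnSn _) e1, ef_le (leqnSn _) e2).
have cl1 a y y' : local_ef q r ((y, y') :: p1) -> a \in p1 ->
  d a.1 y <= r \/ d a.2 y' <= r -> forall a' b, a' \in (y, y') :: p1 -> b \in p2 ->
    K < d a'.1 b.1 /\ K < d a'.2 b.2.
  move=> e ap le a' b; rewrite inE => /orP[/eqP->|/far f /f /=]; last by lia.
  move=> /(far _ _ ap) /=.
  have [_ _ /(_ r (leqnn _)) /= E] :=
    local_ef_pair e (mem_behead (s := _ :: _) ap) (mem_head _ _).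
  have := dT a.1 y b.1; have := dT a.2 y' b.2.
  by rewrite /= in le *; rewrite E in le; lia.
have cl2 a y y' : local_ef q r ((y, y') :: p2) -> a \in p2 ->
  d a.1 y <= r \/ d a.2 y' <= r -> forall b a', b \in p1 -> a' \in (y, y') :: p2 ->
    K < d b.1 a'.1 /\ K < d b.2 a'.2.
  move=> e ap le b a' bp; rewrite inE => /orP[/eqP->|/(far _ _ bp)/=]; last by lia.
  have /= := far _ _ bp ap.
  have [_ _ /(_ r (leqnn _)) /= E] :=
    local_ef_pair e (mem_behead (s := _ :: _) ap) (mem_head _ _).
  have := dT b.1 y a.1; have := dT b.2 y' a.2; rewrite ![d y a.1]dC ![d y' a.2]dC.
  by rewrite /= in le *; rewrite E in le; lia.
have swap (y y' : G) : {subset (y, y') :: (p1 ++ p2) <= p1 ++ (y, y') :: p2}.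
  by move=> b; rewrite !(inE, mem_cat); case: (_ == _) => //=; rewrite orbT.
apply/efSP; split.
- by apply: IH => // a b ap bp; have := far _ _ ap bp; lia.
- move=> y a; rewrite mem_cat local_nearE => /orP[ap|ap] le.
  + have [y' e] := local_ef_move e1 ap le; exists y'.
    by apply: (IH (_ :: p1)) => //; apply: cl1 e ap _; left.
  + have [y' e] := local_ef_move e2 ap le; exists y'; apply: ef_sub (swap y y') _.
    by apply: (IH p1) => //; apply: cl2 e ap _; left.
- move=> y' a; rewrite mem_cat local_nearE => /orP[ap|ap] le.
  + have [y e] := local_ef_comove e1 ap le; exists y.
    by apply: (IH (_ :: p1)) => //; apply: cl1 e ap _; right.
  + have [y e] := local_ef_comove e2 ap le; exists y; apply: ef_sub (swap y y') _.
    by apply: (IH p1) => //; apply: cl2 e ap _; right.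
Qed.

Lemma local_ef_comoves q r p (s : seq G) :
  (forall z, z \in s -> exists2 a, a \in p & d a.2 z <= r) ->
  local_ef (q + size s) r p ->
  exists2 s', size s' = size s & local_ef q r (zip s' s ++ p).
Proof.
elim: s q => [|z s IH] q near; first by rewrite addn0; exists [::].
rewrite /= addnS -addSn => /IH[z' zs|s' ss e].
  by apply: near; rewrite inE zs orbT.
have [a ap le] := near z (mem_head _ _).
have [|w ew] := local_ef_comove e (a := a) (y' := z) _ le.
  by rewrite mem_cat ap orbT.
by exists (w :: s') => //=; rewrite ss.
Qed.

(* Suppose every vertex similar to y lies within rho of p on the second side.
   Then a maximal 2rho-scattered set of such vertices has at most size p
   elements, and pulling it back yields a maximal 2rho-scattered set on the
   first side; y is within 2rho of it, so the game lets us answer y by a vertex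
   similar to y and as far from p as y is. *)
Lemma local_ef_extend q r p y : 0 < r ->
  local_ef (q + size p).+1 (q.*2.+1 * r).*2 p ->
  exists y', local_ef q r ((y, y') :: p).
Proof.
set rho := q.*2.+1 * r => r0 e.
have le_rho : r <= rho.*2 by rewrite /rho; nia.
have weak k p' : q <= k -> local_ef k rho.*2 p' -> local_ef q r p'.
  by move=> ?; apply: local_ef_le.
case: (boolP (has (fun a => d a.1 y <= rho) p)) => [/hasP[a ap /= le]|/hasPn yfar].
  have [|y' e'] := local_ef_move (y := y) e ap; first by apply: leq_trans le _; lia.
  by exists y'; apply: weak e'; lia.
pose tau z := local_ef q r [:: (y, z)].
have tauy : tau y by apply: ef_refl => a; rewrite inE => /eqP->.
have tau_trans z w : tau z -> local_ef q r [:: (w, z)] -> tau w.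
  by move=> tz /ef_sym e1; apply: (ef_trans (t := [:: (y, z, w)]) tz e1).
(* Similarity and distance suffice: [local_ef_cat] glues the game on (y, y') to the game on [p]. *)
suff [y' ty' far'] : exists2 y', tau y' & forall a, a \in p -> rho < d a.2 y'.
  exists y'; apply: (local_ef_cat (p1 := [:: (y, y')])) => //.
    by apply: weak e; lia.
  move=> a b; rewrite inE => /eqP-> /= bp.
  by rewrite (dC y) (dC y') far' // ltnNge yfar.
case: (boolP [exists z, tau z && all (fun a => rho < d a.2 z) p]) =>
  [/existsP[z /andP[tz /allP fz]]|/existsPn nofar]; first by exists z.
have close z : tau z -> exists2 a, a \in p & d a.2 z <= rho.
  move=> tz; have := nofar z; rewrite tz -has_predC => /hasP[a ap /= le].
  by exists a => //; rewrite leqNgt.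
pose scattered (S : {set G}) := [forall x in S, tau x
  && [forall z in S, (x != z) ==> (rho.*2 < d x z)]].
have scatteredP (S : {set G}) : reflect ({in S, forall x, tau x}
    /\ {in S &, forall x z, x != z -> rho.*2 < d x z}) (scattered S).
  apply: (iffP forall_inP) => [H|[H1 H2] x xS].
    split=> [x /H/andP[]//|x z /H/andP[_ /forall_inP Hx] /Hx/implyP]; exact.
  by rewrite H1 //; apply/forall_inP => z zS; apply/implyP; apply: H2.
have scat0 : scattered set0 by apply/scatteredP; split=> x; rewrite inE.
have [S /scatteredP[Stau Sfar] Smax] := arg_maxnP (fun S : {set G} => #|S|) scat0.
pose near_idx z := find (fun a => d a.2 z <= rho) p.
have near_lt z : tau z -> has (fun a => d a.2 z <= rho) p.
  by move=> /close[a ap le]; apply/hasP; exists a.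
(* Two scattered vertices near the same entry of [p] would be within 2rho of each other, so
   [near_idx] is injective on [S]. *)
have Ssize : size (enum S) <= size p.
  rewrite -(size_map near_idx) -(size_iota 0 (size p)); apply: uniq_leq_size.
    rewrite map_inj_in_uniq ?enum_uniq // => x z; rewrite !mem_enum => xS zS eq_idx.
    apply/eqP; case: (boolP (x == z)) => // /(Sfar _ _ xS zS).
    have := nth_find (y, y) (near_lt x (Stau x xS)).
    have := nth_find (y, y) (near_lt z (Stau z zS)).
    rewrite -/(near_idx x) -/(near_idx z) eq_idx => /= le1 le2.
    by have := dT x (nth (y, y) p (near_idx z)).2 z; rewrite [d x _.2]dC; lia.
  move=> _ /mapP[z + ->]; rewrite mem_enum => zS.
  by rewrite mem_iota -has_find near_lt // Stau.
(* Pulling back at most [size p] vertices leaves q+1 rounds: one to answer y, and q for the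
   conclusion. *)
have [||s' ss es] := @local_ef_comoves q.+1 rho.*2 p (enum S).
- move=> z; rewrite mem_enum => /Stau/close[a ap le]; exists a => //; apply: leq_trans le _; lia.
- by apply: local_ef_le e => //; lia.
have zipP w : w \in s' -> exists2 z, z \in S & (w, z) \in zip s' (enum S).
  rewrite -[in w \in s'](unzip1_zip (s := s') (t := enum S)) ?ss //.
  move=> /mapP[[u z] uz /= ->]; exists z => //.
  rewrite -mem_enum -(unzip2_zip (s := s') (t := enum S)) ?ss //.
  by apply/mapP; exists (u, z).
have tau_s w : w \in s' -> tau w.
  move=> /zipP[z zS wz]; apply: tau_trans (Stau z zS) _.
  apply: (ef_sub (p := zip s' (enum S) ++ p)); last by apply: weak es; lia.
  by move=> b; rewrite inE => /eqP->; rewrite mem_cat wz.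
have far_s : {in s' &, forall x z, x != z -> rho.*2 < d x z}.
  move=> x z /zipP[x0 x0S xx] /zipP[z0 z0S zz].
  have in_cat a : a \in zip s' (enum S) -> a \in zip s' (enum S) ++ p.
    by rewrite mem_cat => ->.
  have [/= -> _ E] := local_ef_pair es (in_cat _ xx) (in_cat _ zz).
  by rewrite ltnNge E // -ltnNge; apply: Sfar.
have s'_uniq : uniq s'.
  have ez : zip s' (enum S) = [seq (a.1, a.2) | a <- zip s' (enum S)].
    by rewrite -[LHS]map_id; apply: eq_map => -[].
  rewrite -(unzip1_zip (s := s') (t := enum S)) ?ss //.
  have : uniq (zip s' (enum S)) by apply: zip_uniqr; rewrite ?enum_uniq.
  move=> uz; rewrite map_inj_in_uniq // => -[x x0] [z z0] xx zz /= eq_xz.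
  have in_cat a : a \in zip s' (enum S) -> a \in zip s' (enum S) ++ p.
    by rewrite mem_cat => ->.
  have [/= E _ _] := local_ef_pair es (in_cat _ xx) (in_cat _ zz).
  by move: E; rewrite eq_xz eqxx => /esym/eqP->.
(* The pulled-back set lives in the same graph and already has the maximum size, so adding y cannot
   give a scattered set. *)
have /hasP[w ws le] : has (fun w => d w y <= rho.*2) s'.
  apply: contraT => /hasPn faryw.
  have ynot : y \notin s' by apply/negP => /faryw; rewrite d0.
  have := Smax [set x in y :: s'].
  rewrite /= cardsE (card_uniqP _) /= ?ynot // ss -cardE ltnn; apply.
  apply/scatteredP; split.
    by move=> x; rewrite !inE => /orP[/eqP->|/tau_s].
  move=> x z; rewrite !inE => /orP[/eqP->|xs] /orP[/eqP->|zs].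
  + by rewrite eqxx.
  + by move=> _; rewrite dC ltnNge; apply: faryw.
  + by move=> _; rewrite ltnNge; apply: faryw.
  + exact: far_s.
have [z zS wz] := zipP w ws.
have [|y' e'] := local_ef_move (a := (w, z)) (y := y) es _ le.
  by rewrite mem_cat wz.
exists y'.
  apply: (ef_sub (p := (y, y') :: zip s' (enum S) ++ p)); last by apply: weak e'.
  by move=> b; rewrite !inE => ->.
move=> a ap; have [||_ _ E] := local_ef_pair (a := a) (b := (y, y')) e'.
- by rewrite inE mem_cat ap !orbT.
- by rewrite inE eqxx.
have le2 : rho <= rho.*2 by rewrite -addnn leq_addr.
by have := yfar a ap; rewrite ltnNge (E rho le2).
Qed.
End LocalGame.

(** The bounds depend on the formula alone. Connectives take maxima; a quantifier costs the rounds
    and the radius that [local_ef_extend] spends on a tuple of n entries. *)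
Theorem gaifman m n (phi : formula m n) : exists q r, 0 < r /\
  forall (G : graph) (col : coloring m G) (d : G -> G -> nat), edge_metric d ->
  forall e e' : n.-tuple G, local_ef col d q r (zip e e') ->
  sat col phi e = sat col phi e'.
Proof.
have mem_zip (G : graph) k (e e' : k.-tuple G) i : (tnth e i, tnth e' i) \in zip e e'.
  apply/(nthP (tnth e i, tnth e' i)); exists i.
    by rewrite size_zip !size_tuple minnn.
  by rewrite nth_zip ?size_tuple // -!tnth_nth.
elim: phi => {n} [n|n i j|n i j|n c i|n p1 IH1 p2 IH2|n p IH].
- by exists 0, 1.
- exists 0, 1; split=> // G col d _ e e' H /=.
  by have [-> _ _] := local_ef_pair H (mem_zip _ _ _ _ i) (mem_zip _ _ _ _ j).
- exists 0, 1; split=> // G col d _ e e' H /=.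
  by have [_ -> _] := local_ef_pair H (mem_zip _ _ _ _ i) (mem_zip _ _ _ _ j).
- exists 0, 1; split=> // G col d _ e e' /ef_consistent/consistentP[H _] /=.
  by have /setP/(_ c) := H _ (mem_zip _ _ _ _ i); rewrite !inE.
- have [q1 [r1 [r1_0 H1]]] := IH1; have [q2 [r2 [r2_0 H2]]] := IH2.
  exists (maxn q1 q2), (maxn r1 r2); split=> [|G col d dP e e' H /=]; first by lia.
  rewrite (H1 G col d dP e e'); last by apply: local_ef_le H; lia.
  by rewrite (H2 G col d dP e e') //; apply: local_ef_le H; lia.
have [q [r [r0 H]]] := IH.
exists (q + n).+1, (q.*2.+1 * r).*2; split=> [|G col d dP]; first by nia.
suff one (e e' : n.-tuple G) : local_ef col d (q + n).+1 (q.*2.+1 * r).*2 (zip e e') ->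
    sat col (FEx p) e -> sat col (FEx p) e'.
  move=> e e' E; apply/idP/idP; first exact: one E.
  apply: one; have := ef_sym E; rewrite -/(local_ef _ _ _ _ _).
  set z := [seq _ | _ <- _]; suff -> : z = zip e' e by [].
  rewrite /z; move: (tval e) (tval e') (size_tuple e) (size_tuple e') => s s' <-.
  by elim: s s' => [|x s IHs] [|x' s'] //= [/IHs->].
move=> E /= /existsP[y satp]; apply/existsP.
have [|y' E'] := @local_ef_extend _ _ col _ dP q r (zip e e') y r0.
  by rewrite size_zip !size_tuple minnn.
by exists y'; rewrite -(H G col d dP [tuple of y :: e] [tuple of y' :: e']).
Qed.

(** * Clique-width of recursively decomposed graphs *)

Section Width.
Variables (G : graph) (T : finType) (D : {set G}).

(** The adjacency matrix between [A] and the rest of [D] has at most [#|T|] distinct rows. *)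
Definition width_le (A : {set G}) : Prop :=
  exists c : G -> T, forall u v w, u \in A -> v \in A -> w \in D :\: A ->
    c u = c v -> edge G u w = edge G v w.

Inductive decomposable : {set G} -> Prop :=
| decomposable0 : decomposable set0
| decomposable1 x : width_le [set x] -> decomposable [set x]
| decomposableU A B : decomposable A -> decomposable B -> [disjoint A & B] ->
    width_le (A :|: B) -> decomposable (A :|: B).
End Width.

Section Realizable.
Variables (k : nat) (G : finType).
Implicit Types (A B : {set G}) (l : G -> 'I_k) (E : rel G).

(** [E] is arbitrary because the intermediate graphs of an expression still lack edges of the target
    graph. *)
Definition realizable A l E : Prop :=
  exists (e : cw_expr k) (f : cw_eval e -> G),
    [/\ injective f, A = f @: [set: cw_eval e],
        forall y z, edge (cw_eval e) y z = E (f y) (f z)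
      & forall y, label y = l (f y)].

Lemma realizable_ext A l E l' E' :
  {in A, l =1 l'} -> {in A &, forall x y, E x y = E' x y} ->
  realizable A l E -> realizable A l' E'.
Proof.
move=> hl hE [e [f [fI fA fE fl]]]; exists e, f.
have fin y : f y \in A by rewrite fA imset_f.
by split=> // [y z|y]; rewrite ?fE ?hE ?fl ?hl.
Qed.

Lemma realizable_vert x i E : E x x = false -> realizable [set x] (fun=> i) E.
Proof.
move=> Exx; exists (CWVert i), (fun=> x); split=> //; first by case; case.
by apply/setP=> y; rewrite inE; apply/eqP/imsetP => [->|[]] //; exists tt.
Qed.

Lemma realizable_union A B l l' E E' : [disjoint A & B] ->
  realizable A l E -> realizable B l' E' ->
  realizable (A :|: B) (fun x => if x \in A then l x else l' x)
    (fun x y => if x \in A then (y \in A) && E x y else (y \notin A) && E' x y).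
Proof.
move=> AB [e [f [fI fA fE fl]]] [e' [f' [fI' fA' fE' fl']]].
have inA y : f y \in A by rewrite fA imset_f.
have inB y : f' y \in A = false.
  by apply: (disjointFl AB); rewrite fA' imset_f.
exists (CWUnion e e'), (fun u => match u with inl y => f y | inr y => f' y end).
split.
- move=> [y|y] [z|z] // eq_yz; first by rewrite (fI _ _ eq_yz).
  + by have := inA y; rewrite eq_yz inB.
  + by have := inA z; rewrite -eq_yz inB.
  + by rewrite (fI' _ _ eq_yz).
- apply/setP=> x; rewrite inE fA fA'; apply/orP/imsetP.
    by case=> /imsetP[y _ ->]; [exists (inl y)|exists (inr y)].
  by case=> -[y|y] _ ->; [left|right]; rewrite imset_f.
- by move=> [y|y] [z|z] /=; rewrite ?inA ?inB //= ?fE ?fE'.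
- by move=> [y|y] /=; rewrite ?inA ?inB.
Qed.

Lemma realizable_relabel A l E i j : realizable A l E ->
  realizable A (fun x => if l x == i then j else l x) E.
Proof.
move=> [e [f [fI fA fE fl]]]; exists (CWRelabel i j e), f; split=> // y.
by rewrite -fl.
Qed.

Lemma realizable_join A l E i j : i != j -> realizable A l E ->
  realizable A l (fun x y => [|| E x y, (l x == i) && (l y == j)
                               | (l x == j) && (l y == i)]).
Proof.
move=> ij [e [f [fI fA fE fl]]]; exists (CWJoin ij e), f; split=> //= y z.
by rewrite /join_edge fE !fl.
Qed.
End Realizable.

(* Labels are triples of copies of T: at a union the left and right labels are
   moved from zone 0 to zones 1 and 2, so that all the relabellings go from one
   zone to another and do not interfere. *)
Section Zones.
Variables (T G : finType).
Implicit Types (A B : {set G}) (E : rel G) (z : G -> 'I_3) (c : G -> T).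

Definition zone_label (i : 'I_3) (t : T) : 'I_#|{: 'I_3 * T}| :=
  enum_rank (i, t).

Lemma zone_labelE i t j u : (zone_label i t == zone_label j u) = (i == j) && (t == u).
Proof. by rewrite /zone_label (inj_eq enum_rank_inj) xpair_eqE. Qed.

Lemma realizable_zone A z c E i j (g : T -> T) : i != j ->
  realizable A (fun x => zone_label (z x) (c x)) E ->
  realizable A (fun x => if z x == i then zone_label j (g (c x))
                         else zone_label (z x) (c x)) E.
Proof.
move=> ij H.
suff : forall s : seq T, realizable A
    (fun x => if (z x == i) && (c x \in s) then zone_label j (g (c x))
              else zone_label (z x) (c x)) E.
  move=> /(_ (enum T)); apply: realizable_ext => // x _ /=.
  by rewrite mem_enum inE andbT.
elim=> [|t s IH].
  by apply: realizable_ext H => // x _ /=; rewrite andbF.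
apply: realizable_ext (realizable_relabel (zone_label i t) (zone_label j (g t)) IH) => // x _ /=.
rewrite inE; case: (z x =P i) => [zi|/eqP zi] /=; last by rewrite zone_labelE (negPf zi).
case: (c x =P t) => [ct|/eqP ct] /=.
  case: (c x \in s); rewrite zone_labelE ?ct ?zi ?eqxx //=.
  by rewrite eq_sym (negPf ij).
case: (c x \in s); rewrite zone_labelE ?zi ?eqxx /= ?(negPf ct) //.
by rewrite eq_sym (negPf ij).
Qed.

Lemma realizable_joins A (l : G -> 'I_#|{: 'I_3 * T}|) E (i j : 'I_3) (s : seq (T * T)) :
  i != j -> realizable A l E ->
  realizable A l (fun x y => E x y || has (fun ab =>
    (l x == zone_label i ab.1) && (l y == zone_label j ab.2)
    || (l x == zone_label j ab.2) && (l y == zone_label i ab.1)) s).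
Proof.
move=> ij H; elim: s => [|ab s IH].
  by apply: realizable_ext H => // x y _ _ /=; rewrite orbF.
have ne : zone_label i ab.1 != zone_label j ab.2 by rewrite zone_labelE (negPf ij).
apply: realizable_ext (realizable_join ne IH) => // x y _ _ /=.
by rewrite -!orbA; case: (E x y) => //=; rewrite orbC -!orbA.
Qed.
End Zones.

Section CliqueWidth.
Variables (G : graph) (T : finType).

(** Invariant: the label of a vertex determines its row towards the complement of [A]. The edges
    between two merged parts then depend on pairs of labels only, and joins can add them. *)
Lemma decomposable_realizable (A : {set G}) :
  decomposable T [set: G] A -> A != set0 ->
  exists2 c : G -> T, forall u v w, u \in A -> v \in A -> w \notin A ->
      c u = c v -> edge G u w = edge G v w
    & realizable A (fun x => zone_label ord0 (c x)) (edge G).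
Proof.
elim=> {A} [|x [c cP] _|A B _ IHA _ IHB AB [c cP]]; first by rewrite eqxx.
  exists c; first by move=> u v w; move: (cP u v w); rewrite !inE andbT.
  apply: realizable_ext (realizable_vert (zone_label ord0 (c x)) (edge_irrefl x)) => //.
  by move=> y; rewrite inE => /eqP->.
have cP' u v w : u \in A :|: B -> v \in A :|: B -> w \notin A :|: B ->
    c u = c v -> edge G u w = edge G v w.
  by move=> *; apply: cP => //; rewrite inE; apply/andP.
have [->|A0] := eqVneq A set0; first by rewrite set0U => B0; apply: IHB.
have [->|B0] := eqVneq B set0; first by rewrite setU0 => _; apply: IHA.
move=> _; have [cA cAP RA] := IHA A0; have [cB cBP RB] := IHB B0.
pose zone1 : 'I_3 := inord 1; pose zone2 : 'I_3 := inord 2.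
have z01 : ord0 != zone1 by rewrite -val_eqE /= inordK.
have z02 : ord0 != zone2 by rewrite -val_eqE /= inordK.
have z12 : zone1 != zone2 by rewrite -val_eqE /= !inordK.
have inBA x : x \in B -> x \in A = false by move=> xB; apply: disjointFl AB xB.
have inAB x : x \in A -> x \in B = false by move=> xA; apply: disjointFr AB xA.
have {}RA := realizable_zone id z01 RA; have {}RB := realizable_zone id z02 RB.
have RU := realizable_union AB RA RB.
pose joined ab := [exists x in A, exists y in B,
  [&& cA x == ab.1, cB y == ab.2 & edge G x y]].
have {RA RB RU} RJ := realizable_joins (filter joined (enum {: T * T})) z12 RU.
pose side x := if x \in A then zone1 else zone2.
pose cU x := if x \in A then cA x else cB x.
have joinedE x y : x \in A -> y \in B -> joined (cA x, cB y) = edge G x y.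
  move=> xA yB; apply/idP/idP => [/exists_inP[x' x'A /exists_inP[y' y'B]]|e].
    case/and3P=> /= /eqP ex /eqP ey.
    have y'A : y' \notin A by rewrite inBA.
    have xB : x \notin B by rewrite inAB.
    by rewrite (cAP x' x) // edge_sym (cBP y' y) // edge_sym.
  by apply/exists_inP; exists x => //; apply/exists_inP; exists y; rewrite ?eqxx.
have {RJ} RE : realizable (A :|: B) (fun x => zone_label (side x) (cU x)) (edge G).
  apply: realizable_ext RJ => [x _|x y xU yU] /=.
    by rewrite /side /cU; case: (x \in A).
  have hasE u v : has (fun ab => (zone_label zone1 u == zone_label zone1 ab.1)
      && (zone_label zone2 v == zone_label zone2 ab.2)
      || (zone_label zone1 u == zone_label zone2 ab.2)
      && (zone_label zone2 v == zone_label zone1 ab.1))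
      (filter joined (enum {: T * T})) = joined (u, v).
    apply/hasP/idP => [[[a b]]|J].
      rewrite mem_filter /= !zone_labelE !eqxx (negPf z12) /= orbF => /andP[J _].
      by case/andP=> /eqP-> /eqP->.
    exists (u, v); first by rewrite mem_filter /= J mem_enum.
    by rewrite /= !zone_labelE !eqxx.
  have hasE' u v : has (fun ab => (zone_label zone2 v == zone_label zone1 ab.1)
      && (zone_label zone1 u == zone_label zone2 ab.2)
      || (zone_label zone2 v == zone_label zone2 ab.2)
      && (zone_label zone1 u == zone_label zone1 ab.1))
      (filter joined (enum {: T * T})) = joined (u, v).
    rewrite -hasE; apply: eq_has => ab /=.
    by rewrite orbC [X in X || _]andbC [X in _ || X]andbC.
  have same i u v : i = zone1 \/ i = zone2 ->
      has (fun ab => (zone_label i v == zone_label zone1 ab.1)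
      && (zone_label i u == zone_label zone2 ab.2)
      || (zone_label i v == zone_label zone2 ab.2)
      && (zone_label i u == zone_label zone1 ab.1))
      (filter joined (enum {: T * T})) = false.
    move=> zi; apply/hasPn => -[a b] _ /=; rewrite !zone_labelE.
    by case: zi => ->; rewrite ?(negPf z12) ?[zone2 == zone1]eq_sym ?(negPf z12) ?andbF.
  move: xU yU; rewrite !inE => /orP[xA|xB] /orP[yA|yB].
  - by rewrite xA yA /= same ?orbF //; left.
  - by rewrite xA (inBA _ yB) /= hasE joinedE.
  - by rewrite yA (inBA _ xB) /= hasE' joinedE // edge_sym.
  - by rewrite (inBA _ xB) (inBA _ yB) /= same ?orbF //; right.
(* A color of a part is translated into the color under [c] of some vertex carrying it. Vertices
   with one color in the part may differ under [c], but their rows outside the union are equal, so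
   any representative will do. *)
pose rep (X : {set G}) (cX : G -> T) (a : T) :=
  if [pick x in X | cX x == a] is Some x then c x else a.
have repE (X : {set G}) (cX : G -> T) x : x \in X ->
    exists y, [/\ y \in X, cX y = cX x & rep X cX (cX x) = c y].
  move=> xX; rewrite /rep; case: pickP => [y /andP[yX /eqP e]|/(_ x)].
    by exists y.
  by rewrite /= xX eqxx.
exists (fun x => if x \in A then rep A cA (cA x) else rep B cB (cB x)).
  have one x w : x \in A :|: B -> w \notin A :|: B ->
      exists y, [/\ y \in A :|: B, edge G x w = edge G y w &
        (if x \in A then rep A cA (cA x) else rep B cB (cB x)) = c y].
    rewrite inE => /orP[xA|xB] wU.
      have [y [yA ey ->]] := repE A cA x xA; exists y; rewrite xA inE yA.
      split=> //; apply: cAP => //; apply: contraNN wU.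
      by rewrite inE => ->.
    have [y [yB ey ->]] := repE B cB x xB; exists y; rewrite (inBA _ xB) inE yB orbT.
    split=> //; apply: cBP => //; apply: contraNN wU.
    by rewrite inE orbC => ->.
  move=> u v w uU vU wU; have [u' [u'U -> ->]] := one u w uU wU.
  by have [v' [v'U -> ->]] := one v w vU wU; apply: cP'.
have {}RE := realizable_zone (rep A cA) (i := zone1) (j := ord0) _ RE.
rewrite eq_sym in z01; rewrite eq_sym in z02.
have {}RE := RE z01.
pose side' x := if x \in A then ord0 else zone2.
pose cU' x := if x \in A then rep A cA (cA x) else cB x.
have {}RE : realizable (A :|: B) (fun x => zone_label (side' x) (cU' x)) (edge G).
  apply: realizable_ext RE => // x _; rewrite /side /side' /cU /cU'.
  by case: (x \in A); rewrite ?eqxx // eq_sym (negPf z12).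
apply: realizable_ext (realizable_zone (rep B cB) z02 RE) => // x _ /=.
rewrite /side' /cU'; case: (x \in A); rewrite ?eqxx //.
by rewrite eq_sym (negPf z02).
Qed.

Theorem decomposable_cliquewidth : decomposable T [set: G] [set: G] ->
  cliquewidth_at_most #|{: 'I_3 * T}| G.
Proof.
move=> dec; have [G0|[x _]] := set_0Vmem [set: G].
  by left; rewrite -cardsT G0 cards0.
right; have [|c _ [e [f [fI fA fE _]]]] := decomposable_realizable dec.
  by apply/set0Pn; exists x.
exists e; exists f => // .
apply: inj_card_bij fI _; have := leq_imset_card f [set: cw_eval e].
by rewrite -fA !cardsT.
Qed.
End CliqueWidth.

(** * First-order interpretations and decompositions *)

Definition layering (G : graph) (lay : G -> nat) : Prop :=
  forall x y, edge G x y -> lay x <= (lay y).+1.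

Definition layer_dist (G : Type) (lay : G -> nat) (x y : G) : nat :=
  (lay x - lay y) + (lay y - lay x).

Lemma layer_dist_metric (G : graph) (lay : G -> nat) :
  layering lay -> edge_metric (layer_dist lay).
Proof.
move=> layP; rewrite /layer_dist; split=> [x|x y|x y z|x y e]; try lia.
by have := layP _ _ e; rewrite edge_sym in e; have := layP _ _ e; lia.
Qed.

(** [J] is a list and not an interval, because a window of slices may skip empty ones. *)
Definition layers (G : graph) (lay : G -> nat) (J : seq nat) : {set G} :=
  [set x | lay x \in J].

(** * Composition of the local game across a cut *)

Section SideGame.
Variables (m : nat) (G : graph) (col : coloring m G) (lay : G -> nat).
Variables (k : nat) (J : seq nat) (T : finType) (A : {set G}) (c : G -> T).
Hypothesis sizeJ : size J <= k.
Hypothesis AJ : A \subset layers lay J.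
Hypothesis cP : forall u v w, u \in A -> v \in A -> w \in layers lay J :\: A ->
  c u = c v -> edge G u w = edge G v w.

Definition side_color : finType := ({set 'I_m} * T * 'I_k.+1)%type.
Definition side_reltype : finType := (bool * bool * bool)%type.

(** All that a vertex outside [A] can perceive of [x]: its colors, its row across the cut and its
    layer. The layer is stored as a position in [J], which takes boundedly many values. *)
Definition side_chi (x : G) : side_color :=
  (colors_of col x, c x, inord (index (lay x) J)).

(** The last component makes the vertices of [A] the legal moves, however far apart; distances are
    already fixed by the layers in [side_chi]. *)
Definition side_rel (x y : G) : side_reltype := (x == y, edge G x y, y \in A).

Definition side_near : pred side_reltype := fun b => b.2.

Definition side_type (q : nat) (x : G) : game_type side_color side_reltype q 1 :=
  type_of side_chi side_rel side_near q [tuple x].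

Variable r : nat.
Local Notation d := (layer_dist lay).

(** Keeps q moves of radius r inside the layers [J], the only place where [c] controls adjacency to
    vertices outside [A]. *)
Definition deep (q : nat) (x : G) : Prop :=
  forall y, d x y <= q * r -> lay y \in J.

Lemma deep_move q x y : deep q.+1 x -> d x y <= r -> deep q y.
Proof.
move=> dx xy z yz; apply: dx; move: xy yz; rewrite mulSn /layer_dist.
by move: (lay x) (lay y) (lay z) (q * r) => *; lia.
Qed.

Lemma deep_lay q x y : lay x = lay y -> deep q x -> deep q y.
Proof. by move=> e dx z; rewrite /layer_dist -e; apply: dx. Qed.

Lemma side_chi_lay x y : x \in A -> y \in A -> side_chi x = side_chi y ->
  [/\ colors_of col x = colors_of col y, c x = c y & lay x = lay y].
Proof.
move=> /(subsetP AJ); rewrite inE => xJ /(subsetP AJ); rewrite inE => yJ.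
case=> -> -> /(congr1 val) /=.
have lt z : z \in J -> index z J < k.+1 by rewrite -index_mem => h; apply: leq_trans h (leqW sizeJ).
rewrite !inordK ?lt // => e; split=> //.
by rewrite -(nth_index 0 xJ) e nth_index.
Qed.

(* Spoiler's moves outside A are answered by the identity. *)
Lemma side_game_local q p1 p2 : p1 != [::] ->
    ef side_chi side_rel side_near q p1 ->
    (forall a, a \in p1 -> [/\ a.1 \in A, a.2 \in A & deep q a.1]) ->
    (forall b, b \in p2 -> [/\ b.1 = b.2, b.1 \in layers lay J :\: A & deep q b.1]) ->
  local_ef col d q r (p1 ++ p2).
Proof.
elim: q p1 p2 => [|q IH] p1 p2 p10.
  move=> /consistentP[H1 H2] in1 in2; apply/consistentP; split.
    move=> a; rewrite mem_cat => /orP[ap|/in2[-> //]].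
    by have [a1 a2 _] := in1 _ ap; have [] := side_chi_lay a1 a2 (H1 _ ap).
  have cross x x' w : (x, x') \in p1 -> (w, w) \in p2 -> local_rel d r x w = local_rel d r x' w.
    move=> xp wp; have [/= xA x'A _] := in1 _ xp.
    have [_ /= wD _] := in2 _ wp; have [_ /= cE lE] := side_chi_lay xA x'A (H1 _ xp).
    have ne z : z \in A -> (z == w) = false.
      by move=> zA; apply/eqP => zw; move: wD; rewrite -zw inE zA.
    apply/eqP; rewrite local_relP !ne // eqxx /layer_dist lE eqxx andbT /=.
    by rewrite (cP xA x'A wD cE).
  have flip x y x' y' : local_rel d r x y = local_rel d r x' y' ->
      local_rel d r y x = local_rel d r y' x'.
    move=> /eqP; rewrite local_relP => e; apply/eqP; rewrite local_relP.
    rewrite [y == x]eq_sym [y' == x']eq_sym [edge G y x]edge_sym.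
    have dC u v : d u v = d v u by rewrite /layer_dist addnC.
    by rewrite [edge G y' x']edge_sym (dC y) (dC y').
  move=> [x x'] [y y']; rewrite !mem_cat => /orP[ap|ap] /orP[bp|bp] /=.
  - have [/= xA x'A _] := in1 _ ap; have [/= yA y'A _] := in1 _ bp.
    have [_ /= cE lE] := side_chi_lay xA x'A (H1 _ ap).
    have [_ /= cE' lE'] := side_chi_lay yA y'A (H1 _ bp).
    have [/= e1 e2 _] := H2 _ _ ap bp.
    by apply/eqP; rewrite local_relP e1 e2 /layer_dist lE lE' !eqxx.
  - by have [/= e _ _] := in2 _ bp; rewrite -e in bp *; apply: cross ap bp.
  - have [/= e _ _] := in2 _ ap; rewrite -e in ap *.
    by apply: flip; apply: cross bp ap.
  - by have [/= -> _ _] := in2 _ ap; have [/= -> _ _] := in2 _ bp.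
move=> e1 in1 in2.
have e1' := ef_le (leqnSn _) e1.
have deepS x : deep q.+1 x -> deep q x.
  by move=> H y le; apply: H; move: le; rewrite mulSn; lia.
have in1' a : a \in p1 -> [/\ a.1 \in A, a.2 \in A & deep q a.1].
  by move=> /in1[a1 a2 /deepS].
have in2' b : b \in p2 -> [/\ b.1 = b.2, b.1 \in layers lay J :\: A & deep q b.1].
  by move=> /in2[a1 a2 /deepS].
have swap (y y' : G) : {subset (y, y') :: (p1 ++ p2) <= p1 ++ (y, y') :: p2}.
  by move=> b; rewrite !(inE, mem_cat); case: (_ == _) => //=; rewrite orbT.
(* A move of the side game has to refer to an earlier element; any element of [p1] serves, whatever
   its distance. *)
have [a0 a0p] : exists a0, a0 \in p1.
  by case: p1 p10 {IH e1 in1 e1' in1' swap} => // a0 p _; exists a0; apply: mem_head.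
have [a01 a02 _] := in1 _ a0p.
have outside y : y \notin A -> deep q y -> local_ef col d q r ((y, y) :: p1 ++ p2).
  move=> yA dy; apply: ef_sub (swap y y) _; apply: IH => // b.
  rewrite inE => /orP[/eqP->|/in2' //]; split=> //=.
  by rewrite inE yA inE dy // /layer_dist subnn.
have inside y y' : y \in A -> y' \in A -> ef side_chi side_rel side_near q ((y, y') :: p1) ->
    deep q y -> local_ef col d q r ((y, y') :: p1 ++ p2).
  move=> yA y'A e dy; apply: (IH (_ :: p1)) => // a.
  by rewrite inE => /orP[/eqP->|/in1'].
have answer y y' : ef side_chi side_rel side_near q ((y, y') :: p1) ->
    (y \in A) = (y' \in A).
  move=> /ef_consistent/consistentP[_ H].
  by have [] := H a0 (y, y') (mem_behead (s := _ :: _) a0p) (mem_head _ _).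
have same_lay a : a \in p1 ++ p2 -> lay a.1 = lay a.2 /\ deep q.+1 a.1.
  rewrite mem_cat => /orP[ap|/in2[-> //]].
  have [a1 a2 da] := in1 _ ap; split=> //.
  have [H _] := consistentP _ _ _ (ef_consistent e1).
  by have [] := side_chi_lay a1 a2 (H _ ap).
apply/efSP; split; first exact: IH.
- move=> y a ap; rewrite local_nearE => le.
  have [_ da] := same_lay a ap; have dy := deep_move da le.
  case: (boolP (y \in A)) => yA; last by exists y; apply: outside.
  have [_ /(_ y a0 a0p yA) [y' e] _] := efSP _ _ _ _ _ e1.
  by exists y'; apply: inside; rewrite -?(answer _ _ e).
- move=> y' a ap; rewrite local_nearE => le.
  have [la /deep_lay-/(_ _ la) da] := same_lay a ap; have dy' := deep_move da le.
  case: (boolP (y' \in A)) => yA; last by exists y'; apply: outside.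
  have [_ _ /(_ y' a0 a0p yA) [y e]] := efSP _ _ _ _ _ e1.
  exists y; have yA' : y \in A by rewrite (answer _ _ e).
  apply: inside => //; apply: deep_lay dy'.
  have [H _] := consistentP _ _ _ (ef_consistent e).
  by have [_ _ ->] := side_chi_lay yA' yA (H _ (mem_head _ _)).
Qed.

Lemma side_type_local q u v w : u \in A -> v \in A -> w \in layers lay J :\: A ->
  deep q u -> deep q w -> side_type q u = side_type q v ->
  local_ef col d q r [:: (u, v); (w, w)].
Proof.
move=> uA vA wD du dw /type_of_ef e.
apply: (side_game_local (p1 := [:: (u, v)])) => // b; rewrite inE => /eqP-> //.
Qed.
End SideGame.

(** * Breadth-first search forests *)

(** Stated for any symmetric relation because the search runs twice: on the graph and on the dual
    relation between faces. *)
Lemma bfs_forest (X : finType) (e : rel X) : symmetric e ->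
  exists (dist : X -> nat) (par : X -> X),
    [/\ forall x, (par x == x) = roots e x,
        forall x, par x != x -> e x (par x) /\ dist x = (dist (par x)).+1
      & forall x y, e x y -> dist x <= (dist y).+1].
Proof.
move=> e_sym; have c_sym := sym_connect_sym e_sym.
pose ball := fix ball n := if n is n'.+1
  then ball n' :|: [set x | [exists y in ball n', e x y]]
  else [set x | roots e x].
have ballS n x y : y \in ball n -> e x y -> x \in ball n.+1.
  move=> yn exy; rewrite /= !inE; apply/orP; right; apply/exists_inP; by exists y.
have ex_ball x : exists n, x \in ball n.
  have /connectP[p] : connect e (fingraph.root e x) x by rewrite c_sym connect_root.
  move: (fingraph.root e x) (roots_root c_sym x) => y ry.
  elim/last_ind: p x => [|p z IH] x; first by move=> _ ->; exists 0; rewrite inE.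
  rewrite rcons_path last_rcons => /andP[pp ez] ->.
  have [n ln] := IH _ pp erefl; exists n.+1; apply: ballS ln _.
  by rewrite e_sym.
pose dist x := ex_minn (ex_ball x).
have in_ball x : x \in ball (dist x) by rewrite /dist; case: ex_minnP.
have dist_min x n : x \in ball n -> dist x <= n.
  by rewrite /dist; case: ex_minnP => k _ H /H.
have distS x y : e x y -> dist x <= (dist y).+1.
  by move=> exy; apply: dist_min; apply: ballS exy.
have dist0 x : (dist x == 0) = roots e x.
  apply/idP/idP => [/eqP d0|rx]; first by have := in_ball x; rewrite d0 inE.
  by rewrite -leqn0; apply: dist_min; rewrite inE.
pose par x := if roots e x then x else odflt x [pick y | e x y && (dist x == (dist y).+1)].
have parP x : ~~ roots e x -> e x (par x) /\ dist x = (dist (par x)).+1.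
  rewrite /par => rx; rewrite (negPf rx); case: pickP => [y /andP[? /eqP]//|no].
  have := in_ball x; move: rx; rewrite -dist0; case dE: (dist x) => [//|n] _ /=.
  rewrite !inE => /orP[/dist_min|/exists_inP[y yn exy]]; first by rewrite dE ltnn.
  have := no y; rewrite exy /= dE eqSS => /eqP[].
  by have := distS _ _ exy; have := dist_min _ _ yn; rewrite dE; lia.
have parE x : (par x == x) = roots e x.
  case: (boolP (roots e x)) => rx; first by rewrite /par rx eqxx.
  by have [_ dx] := parP x rx; apply/eqP => px; move: dx; rewrite px; lia.
by exists dist, par; split=> // x; rewrite parE => /parP.
Qed.

(** * Flags of an embedding scheme *)

Section Flags.
Variables (G : graph) (S : embedding_scheme G).

(* A flag (d, b) is a side of the edge of d together with its end [source d];
   the side is the one met by the corner between d and the next (if b), resp.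
   the previous (if not b), dart around that end. The involutions [flip0],
   [flip1], [flip2] change the end, the edge at the corner and the side. *)
Definition flag : finType := (dart G * bool)%type.

Definition fsource (z : flag) : G := source z.1.
Definition ftarget (z : flag) : G := (val z.1).2.

Definition flip0 (z : flag) : flag := (dart_rev z.1, ~~ (z.2 (+) twisted S z.1)).
Definition flip1 (z : flag) : flag :=
  ((if z.2 then rotation S else (rotation S)^-1%g) z.1, ~~ z.2).
Definition flip2 (z : flag) : flag := (z.1, ~~ z.2).

Lemma dart_revK : involutive (@dart_rev G).
Proof. by move=> d; apply: val_inj; case: d => -[]. Qed.

Lemma dart_rev_neq (d : dart G) : dart_rev d != d.
Proof.
apply/eqP => /(congr1 (source (G := G))) /= e.
by have := valP d; rewrite /= -[X in edge G X _]/(source d) -e edge_irrefl.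
Qed.

Lemma dart_inj (d d' : dart G) :
  source d = source d' -> (val d).2 = (val d').2 -> d = d'.
Proof.
move=> e1 e2; apply: val_inj; move: e1 e2; rewrite /source.
by case: (val d) (val d') => [x y] [x' y'] /= -> ->.
Qed.

Lemma flip0K : involutive flip0.
Proof.
by move=> [d b]; rewrite /flip0 /= dart_revK twisted_rev; case: b; case: twisted.
Qed.

Lemma flip1K : involutive flip1.
Proof. by move=> [d []]; rewrite /flip1 /= ?permK ?permKV. Qed.

Lemma flip2K : involutive flip2.
Proof. by move=> [d []]. Qed.

Lemma flip02 z : flip0 (flip2 z) = flip2 (flip0 z).
Proof. by case: z => d b; rewrite /flip0 /flip2 /=; case: b; case: twisted. Qed.

Lemma flip0_neq z : flip0 z != z.
Proof. by apply/eqP => /(congr1 fst)/= /eqP; rewrite (negPf (dart_rev_neq _)). Qed.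

Lemma flip1_neq z : flip1 z != z.
Proof. by apply/eqP => /(congr1 snd)/=; case: z.2. Qed.

Lemma face_stepE z : face_step S z = flip1 (flip0 z).
Proof. by case: z => d b; rewrite /face_step /flip1 /flip0 /=; case: (_ (+) _). Qed.

Lemma fsource_flip0 z : fsource (flip0 z) = ftarget z. Proof. by []. Qed.
Lemma fsource_flip1 z : fsource (flip1 z) = fsource z.
Proof.
case: z => d b; apply/eqP; rewrite -[fsource (d, b)]/(source d) -(rotation_cyclic S).
rewrite /=; case: b => /=; first exact: (mem_porbit _ 1).
by rewrite porbit_sym -{1}[d](permKV (rotation S)); apply: (mem_porbit _ 1).
Qed.

Lemma flag_edge (z : flag) : edge G (fsource z) (ftarget z).
Proof. exact: (valP z.1). Qed.

Lemma edge_flag x y : edge G x y -> exists z : flag, fsource z = x /\ ftarget z = y.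
Proof. by move=> e; exists (exist _ (x, y) e, true). Qed.

Lemma face_step_inj : injective (face_step S).
Proof.
by apply: eq_inj (inj_comp (inv_inj flip1K) (inv_inj flip0K)) _ => z; rewrite face_stepE.
Qed.

Lemma flip0_face_step z : face_step S (flip0 (face_step S z)) = flip0 z.
Proof. by rewrite !face_stepE flip0K flip1K. Qed.

Lemma fconnect_flip0 x y :
  fconnect (face_step S) x y -> fconnect (face_step S) (flip0 x) (flip0 y).
Proof.
move=> /iter_findex <-; elim: (findex _ x y) => [|n IH] /=; first exact: connect0.
apply: connect_trans IH _; rewrite fconnect_sym; last exact: face_step_inj.
by rewrite -[X in fconnect _ _ X]flip0_face_step fconnect1.
Qed.

(* Otherwise a flag half-way would be fixed by [flip0] or [flip1]. *)
Lemma fconnect_flip0F z : fconnect (face_step S) z (flip0 z) = false.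
Proof.
apply/negP => /iter_findex; move: (findex _ _ _) => n.
elim/ltn_ind: n z => -[|[|n]] IH z /=.
- by move/esym/eqP; rewrite (negPf (flip0_neq z)).
- by rewrite face_stepE => /eqP; rewrite (negPf (flip1_neq _)).
move=> e; apply: (IH n _ (face_step S z)) => //.
apply: face_step_inj; rewrite -iterS -iterSr [LHS]/= e.
by rewrite flip0_face_step.
Qed.

(** Both involutions are used instead of [face_step], so that the two traversals of a face fall into
    one class; its canonical flag names the face. *)
Definition face_rel : rel flag := fun z w => (w == flip0 z) || (w == flip1 z).

Lemma face_rel_sym : symmetric face_rel.
Proof.
move=> z w; rewrite /face_rel ![z == _]eq_sym.
by rewrite (inv_eq flip0K) (inv_eq flip1K).
Qed.

Lemma face_connect_sym : connect_sym face_rel.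
Proof. exact: sym_connect_sym face_rel_sym. Qed.

Definition face (z : flag) : flag := fingraph.root face_rel z.

Lemma face_flip0 z : face (flip0 z) = face z.
Proof.
apply/esym/(fingraph.rootP face_connect_sym)/connect1.
by rewrite /face_rel eqxx.
Qed.

Lemma face_flip1 z : face (flip1 z) = face z.
Proof.
apply/esym/(fingraph.rootP face_connect_sym)/connect1.
by rewrite /face_rel eqxx orbT.
Qed.

Lemma face_step_face z : face (face_step S z) = face z.
Proof. by rewrite face_stepE face_flip1 face_flip0. Qed.

Lemma face_idem z : face (face z) = face z.
Proof. exact: fingraph.root_root face_connect_sym _. Qed.

(** [face_step] is a product of two involutions, so every word in [flip0] and [flip1] is a power of
    it up to one [flip0]. *)
Lemma face_cover z w : face z = face w ->
  fconnect (face_step S) z w || fconnect (face_step S) z (flip0 w).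
Proof.
move=> /(fingraph.rootP face_connect_sym) /connectP[p]; elim/last_ind: p w => [|p y IH] w.
  by move=> _ ->; rewrite connect0.
rewrite rcons_path last_rcons => /andP[pp ey] ->.
have : face_rel (last z p) y by [].
move: ey => _; move: (IH _ pp erefl); move: (last z p) => x {IH pp p}.
have step u : fconnect (face_step S) z u -> fconnect (face_step S) z (flip1 (flip0 u)).
  by move=> zu; rewrite -face_stepE; apply: connect_trans zu (fconnect1 _ _).
have back u : fconnect (face_step S) z u -> fconnect (face_step S) z (flip0 (flip1 u)).
  move=> zu; apply: connect_trans zu _; rewrite fconnect_sym; last exact: face_step_inj.
  have := fconnect1 (face_step S) (flip0 (flip1 u)).
  by rewrite face_stepE flip0K flip1K.
move=> h /orP[] /eqP->; first by rewrite flip0K orbC.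
by case/orP: h => [/back->|/step]; rewrite ?orbT // flip0K => ->.
Qed.

(** By [face_cover], an orbit is determined by its face and by whether it contains the canonical
    flag of that face. *)
Lemma card_face_orbits : fcard (face_step S) predT <= (#|roots face_rel|).*2.
Proof.
have fS := fconnect_sym face_step_inj.
pose h (o : flag) := (face o, fconnect (face_step S) (face o) o).
have hinj : {in froots (face_step S) &, injective h}.
  move=> o o' ro ro' []; move=> eo eb; rewrite -eo in eb.
  suff : fconnect (face_step S) o o'.
    by move=> /(fingraph.rootP fS); rewrite (eqP ro) (eqP ro').
  case: (boolP (fconnect (face_step S) (face o) o)) eb => [c1 /esym c2|c1 c2].
    by apply: connect_trans c2; rewrite fS.
  have flip z : face z = face o -> ~~ fconnect (face_step S) (face o) z ->
      fconnect (face_step S) (flip0 (face o)) z.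
    move=> ez nz; have := face_cover (z := face o) (w := z).
    rewrite face_idem ez (negPf nz) => /(_ erefl) /= /fconnect_flip0.
    by rewrite flip0K.
  apply: (connect_trans (y := flip0 (face o))); first by rewrite fS flip.
  by apply: flip; rewrite -?c2.
rewrite /n_comp_mem (eq_card (B := [set o | froots (face_step S) o])); last first.
  by move=> o; rewrite !inE andbT.
rewrite -[X in X <= _](card_in_imset (f := h)); last first.
  by move=> x y; rewrite !inE => rx ry; apply: hinj.
rewrite -muln2 -card_bool -cardX; apply: subset_leq_card; apply/subsetP => _ /imsetP[o _ ->].
by rewrite !inE andbT; apply: roots_root face_connect_sym _.
Qed.
End Flags.

(** * Contours of breadth-first trees *)

Section Contour.
Variables (G : graph) (S : embedding_scheme G) (lay : G -> nat) (par : G -> G).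
Hypothesis par_lay :
  forall x, par x != x -> edge G x (par x) /\ lay x = (lay (par x)).+1.

Definition tree_dart (d : dart G) : bool :=
  (par (source d) == (val d).2) || (par (val d).2 == source d).

Lemma tree_dart_rev d : tree_dart (dart_rev d) = tree_dart d.
Proof. by rewrite /tree_dart orbC. Qed.

Lemma fconnect_par_split u v : fconnect par u v ->
  u = v \/ exists c, [/\ par c = v, c != v & fconnect par u c].
Proof.
move=> /iter_findex; elim: (findex _ u v) => [|n IH] /=; first by left.
move=> e; have [e'|ne] := eqVneq (iter n par u) v; first exact: IH.
by right; exists (iter n par u); rewrite fconnect_iter.
Qed.

(* Walk around the subtree of [v], from one side of the edge to its parent to
   the other side. *)
Lemma contour (U : Type) (a : flag G -> U) v :
  (forall z, a (flip0 S z) = a z) ->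
  (forall z, fconnect par (fsource z) v -> a (flip1 S z) = a z) ->
  (forall z, fconnect par (fsource z) v -> ~~ tree_dart z.1 -> a (flip2 z) = a z) ->
  forall z z', fconnect par (fsource z) v -> fconnect par (fsource z') v -> a z = a z'.
Proof.
move=> a0; pose M := \max_(x : G) lay x.
have layM x : lay x <= M by apply: leq_bigmax.
have [n] := ubnP (M - lay v); elim: n v => // n IH v lev a1 a2.
have child c : par c = v -> c != v -> forall z z', fconnect par (fsource z) c ->
    fconnect par (fsource z') c -> a z = a z'.
  move=> pc cv; have cn : par c != c by rewrite pc eq_sym.
  have sub u : fconnect par u c -> fconnect par u v.
    by move=> uc; apply: connect_trans uc _; rewrite -pc fconnect1.
  have [_ lc] := par_lay cn; apply: IH => [|z /sub|z /sub]; [|exact: a1|exact: a2].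
  by move: (layM c) lev; rewrite lc pc; lia.
(* Crossing the edge to a child amounts to walking around the child's subtree, where the induction
   applies. *)
have noncross z : fsource z = v -> par v != ftarget z -> a (flip2 z) = a z.
  move=> zv np; case: (boolP (tree_dart z.1)); last first.
    by apply: a2; rewrite zv connect0.
  rewrite /tree_dart -[source _]/(fsource z) zv (negPf np) /= => /eqP pt.
  rewrite -(a0 z) -(a0 (flip2 z)); apply: (child (ftarget z)) => //.
  by have := flag_edge z; rewrite zv; apply: contraTneq => ->; rewrite edge_irrefl.
have around z z' : fsource z = v -> fsource z' = v -> a z = a z'.
  move=> zv z'v.
  (* [d0] is the dart to the parent, the only one that must not be crossed; at a root any dart
     serves. Rotating from [d0] meets every corner at [v] before [d0] would have to be crossed. *)
  have [d0 d0v d0P] : exists2 d0 : dart G, source d0 = v &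
      forall d, source d = v -> d != d0 -> par v != (val d).2.
    have [pv|npv] := eqVneq (par v) v.
      exists z.1 => // d dv _; rewrite pv -dv; apply/eqP => e.
      by have := valP d; rewrite /= -e -/(source d) edge_irrefl.
    have [e _] := par_lay npv; have [w [wv wt]] := edge_flag e.
    exists w.1 => // d dv; apply: contra => /eqP pd; apply/eqP.
    by apply: dart_inj; rewrite ?dv ?wv // -pd -wt.
  have true_side i : a ((rotation S ^+ i)%g d0, true) = a (d0, true).
    elim: i => [|i IHi]; first by rewrite expg0 perm1.
    set d := (rotation S ^+ i)%g d0; have -> : (rotation S ^+ i.+1)%g d0 = rotation S d.
      by rewrite expgSr permM.
    have dv : source d = v.
      by apply/eqP; rewrite -d0v -(rotation_cyclic S) mem_porbit.
    have sv : source (rotation S d) = v by rewrite -dv; apply: (fsource_flip1 S (d, true)).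
    have [->//|dd0] := eqVneq (rotation S d) d0; rewrite -IHi -/d.
    rewrite -(noncross (rotation S d, true)) //; last exact: d0P.
    by rewrite -(a1 (d, true)) // /fsource dv connect0.
  have to_d0 w : fsource w = v -> a w = a (d0, true).
    have true_to d : source d = v -> a (d, true) = a (d0, true).
      move=> dv; have : d \in porbit (rotation S) d0 by rewrite rotation_cyclic d0v dv.
      by move=> /porbitP[i ->]; apply: true_side.
    case: w => d [] wv; first exact: true_to.
    rewrite -a1 ?wv ?connect0 //; apply: true_to.
    by rewrite -[LHS]/(fsource (flip1 S (d, false))) fsource_flip1.
  by rewrite (to_d0 z) // (to_d0 z').
have reach z : fconnect par (fsource z) v -> exists2 w, fsource w = v & a z = a w.
  move=> zv; have [e|[c [pc cv zc]]] := fconnect_par_split zv; first by exists z.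
  have cn : par c != c by rewrite pc eq_sym.
  have [e _] := par_lay cn; have [w [wc wt]] := edge_flag e.
  exists (flip0 S w); first by rewrite fsource_flip0 wt.
  by rewrite a0; apply: (child c) => //; rewrite wc connect0.
move=> z z' /reach[w wv ->] /reach[w' w'v ->]; exact: around.
Qed.
End Contour.

(** * Dual trees *)

Section TreeCotree.
Variables (G : graph) (S : embedding_scheme G) (lay : G -> nat) (par : G -> G).
Hypothesis par_root : forall x, (par x == x) = roots (edge G) x.
Hypothesis par_lay :
  forall x, par x != x -> edge G x (par x) /\ lay x = (lay (par x)).+1.

Let gc_sym : connect_sym (edge G) := sym_connect_sym (@edge_sym G).

Lemma fconnect_par_root x : fconnect par x (fingraph.root (edge G) x).
Proof.
have [n] := ubnP (lay x); elim: n x => // n IH x lex.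
have [px|npx] := eqVneq (par x) x.
  by have := par_root x; rewrite px eqxx => /esym/eqP->; apply: connect0.
have [e lx] := par_lay npx; apply: connect_trans (fconnect1 par x) _.
rewrite (fingraph.rootP gc_sym (connect1 e)); apply: IH.
by move: lex; rewrite lx.
Qed.

(** The contour of a whole tree: crossing only edges outside the tree still connects all the faces
    of a component. *)
Lemma contour_component (U : Type) (a : flag G -> U) :
  (forall z, a (flip0 S z) = a z) -> (forall z, a (flip1 S z) = a z) ->
  (forall z, ~~ tree_dart par z.1 -> a (flip2 z) = a z) ->
  forall z z', fingraph.root (edge G) (fsource z) = fingraph.root (edge G) (fsource z') ->
    a z = a z'.
Proof.
move=> a0 a1 a2 z z' e.
apply: (contour par_lay (v := fingraph.root (edge G) (fsource z)) a0) => //.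
- by move=> w _; apply: a2.
- exact: fconnect_par_root.
- by rewrite e; apply: fconnect_par_root.
Qed.

(** The dual graph without the edges that cross the tree. Flags that name no face are isolated and
    become roots of their own. *)
Definition dual_rel : rel (flag G) := fun x y =>
  [exists w : flag G, [&& ~~ tree_dart par w.1, face S w == x & face S (flip2 w) == y]].

Lemma dual_rel_sym : symmetric dual_rel.
Proof.
suff sub x y : dual_rel x y -> dual_rel y x by move=> x y; apply/idP/idP; apply: sub.
move=> /existsP[w /and3P[nt wx wy]]; apply/existsP; exists (flip2 w).
by rewrite nt wy flip2K wx.
Qed.

Let dc_sym : connect_sym dual_rel := sym_connect_sym dual_rel_sym.

Variables (dist : flag G -> nat) (dpar : flag G -> flag G).
Hypothesis dpar_root : forall x, (dpar x == x) = roots dual_rel x.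
Hypothesis dpar_dist :
  forall x, dpar x != x -> dual_rel x (dpar x) /\ dist x = (dist (dpar x)).+1.

(* The flag through which the face [x] is entered from its parent. *)
Definition entry (x : flag G) : flag G :=
  if dpar x == x then x else odflt x [pick w : flag G |
    [&& ~~ tree_dart par w.1, face S w == x & face S (flip2 w) == dpar x]].

Lemma entryP x : dpar x != x -> [/\ ~~ tree_dart par (entry x).1,
  face S (entry x) = x & face S (flip2 (entry x)) = dpar x].
Proof.
move=> nx; have [/existsP[w wP] _] := dpar_dist nx.
rewrite /entry (negPf nx); case: pickP => [u /and3P[? /eqP ? /eqP ?] //|/(_ w)].
by rewrite wP.
Qed.

Lemma face_entry x : face S x = x -> face S (entry x) = x.
Proof.
by move=> fx; have [e|/entryP[]//] := eqVneq (dpar x) x; rewrite /entry e eqxx.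
Qed.

Lemma dpar_face x : dpar x != x -> face S x = x /\ face S (dpar x) = dpar x.
Proof. by case/entryP=> _ fx gx; rewrite -[x in face S x]fx -gx !face_idem. Qed.

Definition cotree_dart (d : dart G) : bool :=
  [exists x, (dpar x != x) && ((d == (entry x).1) || (d == dart_rev (entry x).1))].

Definition extra_dart (d : dart G) : bool := ~~ tree_dart par d && ~~ cotree_dart d.

Let nonroots : {set G} := [set x | par x != x].
Let dual_nonroots : {set flag G} := [set x | dpar x != x].

Lemma card_tree_darts : (#|nonroots|).*2 <= #|[set d | tree_dart par d]|.
Proof.
pose up := [set d : dart G | par (source d) == (val d).2].
pose down := [set d : dart G | par (val d).2 == source d].
have -> : [set d | tree_dart par d] = up :|: down.
  by apply/setP => d; rewrite !inE.
have dj : up :&: down = set0.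
  apply/setP => d; rewrite !inE; apply/negP => /andP[/eqP e1 /eqP e2].
  have n1 : par (source d) != source d.
    rewrite e1; apply/eqP => e; have := valP d.
    by rewrite /= e -/(source d) edge_irrefl.
  have n2 : par (val d).2 != (val d).2 by rewrite e2 -e1 eq_sym.
  have [_ l1] := par_lay n1; have [_] := par_lay n2.
  by rewrite e2 l1 e1 => /eqP; rewrite ltn_eqF.
rewrite cardsU dj cards0 subn0 -addnn; apply: leq_add.
  apply: leq_trans (leq_imset_card (source (G := G)) _).
  apply: subset_leq_card; apply/subsetP => x; rewrite inE => /par_lay[e _].
  by apply/imsetP; exists (exist _ (x, par x) e); rewrite ?inE.
apply: leq_trans (leq_imset_card (fun d : dart G => (val d).2) _).
apply: subset_leq_card; apply/subsetP => x; rewrite inE => /par_lay[e _].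
rewrite edge_sym in e.
by apply/imsetP; exists (exist _ (par x, x) e); rewrite ?inE.
Qed.

(** Distinct faces entered through the same edge would be parents of each other, against [dist]. *)
Lemma entry_edge x y : dpar x != x -> dpar y != y ->
  (entry y).1 = (entry x).1 \/ (entry y).1 = dart_rev (entry x).1 -> x = y.
Proof.
move=> nx ny; have [_ fx gx] := entryP nx; have [_ fy gy] := entryP ny.
have [[_ dx] [_ dy]] := (dpar_dist nx, dpar_dist ny).
have contra : dpar x = y -> dpar y = x -> x = y.
  by move=> e1 e2; move: dx dy; rewrite e1 e2; lia.
have side (u v : flag G) : u.1 = v.1 -> u = v \/ u = flip2 v.
  by case: u v => [d b] [d' b'] /= ->; case: b b' => [] []; [left|right|right|left].
case=> [/side[e|e]|e].
- by rewrite -fx -fy e.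
- by apply: contra; [rewrite -gx -fy e|rewrite -gy e flip2K].
have /side[e'|e'] : (entry y).1 = (flip0 S (entry x)).1 by [].
  by rewrite -fy e' face_flip0.
apply: contra; first by rewrite -gx -fy e' -flip02 face_flip0.
by rewrite -gy e' flip2K face_flip0.
Qed.

Lemma card_cotree_darts : (#|dual_nonroots|).*2 <= #|[set d | cotree_dart d]|.
Proof.
pose fwd := [set (entry x).1 | x in dual_nonroots].
pose bwd := [set dart_rev (entry x).1 | x in dual_nonroots].
have injf : {in dual_nonroots &, injective (fun x => (entry x).1)}.
  by move=> x y; rewrite !inE => nx ny e; exact: (entry_edge nx ny (or_introl (esym e))).
have injb : {in dual_nonroots &, injective (fun x => dart_rev (entry x).1)}.
  by move=> x y nx ny /(inv_inj (@dart_revK G)); apply: injf.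
have dj : fwd :&: bwd = set0.
  apply/setP => d; rewrite !inE; apply/negP => /andP[/imsetP[x nx ->] /imsetP[y ny e]].
  rewrite !inE in nx ny.
  have e' : (entry y).1 = dart_rev (entry x).1.
    by apply: (inv_inj (@dart_revK G)); rewrite dart_revK; exact: (esym e).
  have exy : x = y := entry_edge nx ny (or_intror e').
  by have := dart_rev_neq (entry y).1; rewrite -e exy eqxx.
have -> : [set d | cotree_dart d] = fwd :|: bwd.
  apply/setP => d; rewrite !inE; apply/existsP/orP.
    move=> [x /andP[nx /orP[/eqP->|/eqP->]]]; [left|right];
      by apply/imsetP; exists x; rewrite ?inE.
  by case=> /imsetP[x]; rewrite inE => nx ->; exists x; rewrite nx eqxx ?orbT.
by rewrite cardsU dj cards0 subn0 !card_in_imset // addnn.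
Qed.

(** By [contour_component], each component of the graph contributes at most one component of the
    dual. Isolated vertices carry no flags, so their components are left over. *)
Lemma card_dual_roots :
  #|[set x | (face S x == x) && (dpar x == x)]| + num_isolated G
  <= num_components G.
Proof.
pose droots := [set x | (face S x == x) && (dpar x == x)].
pose isol := [set v : G | [forall w, ~~ edge G v w]].
pose comp (x : flag G) := fingraph.root (edge G) (fsource x).
have compI : {in droots &, injective comp}.
  move=> x y; rewrite !inE !dpar_root => /andP[/eqP fx rx] /andP[/eqP fy ry] e.
  have := contour_component (a := fun z => fingraph.root dual_rel (face S z)) _ _ _ e.
  rewrite fx fy (eqP rx) (eqP ry); apply=> z.
  - by rewrite face_flip0.
  - by rewrite face_flip1.
  - move=> nt; apply/esym/(fingraph.rootP dc_sym)/connect1/existsP; exists z.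
    by rewrite nt !eqxx.
have isol_connect v w : v \in isol -> connect (edge G) v w -> w = v.
  rewrite inE => /forallP iso /connectP[[|u p] //= /andP[]].
  by rewrite (negPf (iso u)).
have -> : num_isolated G = #|isol|.
  by rewrite /num_isolated; apply: eq_card => v; rewrite !inE.
have -> : num_components G = #|[set v | roots (edge G) v]|.
  by rewrite /num_components /n_comp_mem; apply: eq_card => v; rewrite !inE andbT.
rewrite -(card_in_imset compI).
have dj : comp @: droots :&: isol = set0.
  apply/setP => v; rewrite !inE; apply/negP => /andP[/imsetP[x _ ->] iso].
  have := connect_root (edge G) (fsource x); rewrite gc_sym.
  move=> /isol_connect; rewrite inE => /(_ iso) e.
  by have := flag_edge x; rewrite e (negPf (forallP iso _)).
rewrite -[X in X <= _]subn0 -(cards0 G) -dj -cardsU; apply: subset_leq_card.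
apply/subsetP => v; rewrite !inE => /orP[/imsetP[x _ ->]|vi].
  exact: roots_root gc_sym _.
by apply/eqP; apply: isol_connect (connect_root _ _); rewrite inE.
Qed.

(** Euler's formula: tree edges account for the vertices and cotree edges for the faces, up to one
    per component, so at most g edges remain. Each has two darts; the successor absorbs the rounding
    in [num_edges]. *)
Lemma card_extra_darts g : (scheme_euler_genus S <= g%:Z)%R ->
  #|[set d | extra_dart d]| <= g.*2.+1.
Proof.
rewrite /scheme_euler_genus /num_faces /num_edges => genus.
have [[c1 c2] [c3 c4]] := ((card_tree_darts, card_cotree_darts),
  (card_dual_roots, card_face_orbits S)).
have nv : #|nonroots| + num_components G = #|{: G}|.
  rewrite /num_components /n_comp_mem -(cardsC nonroots); congr (_ + _).
  by apply: eq_card => x; rewrite !inE par_root andbT negbK.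
have nf : #|roots (face_rel S)| = #|dual_nonroots|
    + #|[set x | (face S x == x) && (dpar x == x)]|.
  rewrite -cardsE -(cardsID dual_nonroots); congr (_ + _).
    apply: eq_card => x; rewrite !inE andb_idl // => /dpar_face[fx _].
    exact/eqP.
  by apply: eq_card => x; rewrite !inE andbC negbK.
have nd : #|[set d | extra_dart d]| + #|[set d | tree_dart par d]|
    + #|[set d | cotree_dart d]| <= #|{: dart G}|.
  have dj1 : [set d | extra_dart d] :&: [set d | tree_dart par d] = set0.
    by apply/setP => d; rewrite !inE /extra_dart; case: tree_dart; rewrite ?andbF.
  have dj2 : ([set d | extra_dart d] :|: [set d | tree_dart par d])
      :&: [set d | cotree_dart d] = set0.
    apply/setP => d; rewrite !inE /extra_dart; apply/negP => /andP[+ cd].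
    rewrite cd andbF /=; apply/negP; move: cd => /existsP[x /andP[/entryP[nt _ _]]].
    by case/orP => /eqP->; rewrite ?tree_dart_rev.
  apply: leq_trans (max_card (mem (([set d | extra_dart d]
    :|: [set d | tree_dart par d]) :|: [set d | cotree_dart d]))).
  by rewrite !cardsU dj1 dj2 cards0 !subn0.
have {}genus : 2 * num_components G + #|{: dart G}|./2 <=
    g + #|{: G}| + ((fcard (face_step S) predT)./2 + num_isolated G).
  by move: genus; lia.
lia.
Qed.
End TreeCotree.

(** * Decompositions along a rooted forest *)

Definition sep_type (n : nat) : finType := {ffun 'I_n -> bool * bool}.

Section Separators.
Variables (G : graph) (D : {set G}).
Implicit Types (A B : {set G}) (s : seq G).

Definition separates s A : Prop := forall u v, u \in A -> v \in D :\: A ->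
  edge G u v -> (u \in s) || (v \in s).

Lemma separatesU s t A B :
  separates s A -> separates t B -> separates (s ++ t) (A :|: B).
Proof.
move=> sA tB u v; rewrite !inE => uAB /andP[/norP[vA vB] vD] e.
rewrite !mem_cat; case/orP: uAB => [uA|uB].
  have := sA u v uA _ e; rewrite inE vA vD => /(_ isT).
  by case/orP=> ->; rewrite ?orbT.
have := tB u v uB _ e; rewrite inE vB vD => /(_ isT).
by case/orP=> ->; rewrite ?orbT.
Qed.

(** A vertex in the separator is identified by its color. Any other vertex of [A] sees only
    separator vertices across the cut, and its color records which. *)
Lemma separates_width n s A : size s <= n -> separates s A -> width_le (sep_type n) D A.
Proof.
move=> sn sA.
(* Positions beyond [s] default to u itself and carry no information. *)
pose c u : sep_type n := [ffun i : 'I_n => (u == nth u s i, edge G u (nth u s i))].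
exists c => u v w uA vA wD /ffunP cE.
have at_ x : x \in s -> exists2 i : 'I_n, x = nth u s i & x = nth v s i.
  move=> xs; have lt : index x s < n by apply: leq_trans sn; rewrite index_mem.
  by exists (Ordinal lt); rewrite /= nth_index.
have [/at_ [i iu iv]|us] := boolP (u \in s).
  have := cE i; rewrite !ffunE -iu -iv eqxx => -[/esym/eqP -> //].
have [/at_ [i iu iv]|vs] := boolP (v \in s).
  have := cE i; rewrite !ffunE -iu -iv eqxx => -[/eqP -> //].
have [/at_ [i iu iv]|ws] := boolP (w \in s).
  by have := cE i; rewrite !ffunE -iu -iv => -[_ ->].
have no x : x \in A -> x \notin s -> edge G x w = false.
  by move=> xA xs; apply/negP => /(sA x w xA wD); rewrite (negPf xs) (negPf ws).
by rewrite !no.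
Qed.
End Separators.

Section Forest.
Variables (G : graph) (D : {set G}) (Y : finType) (home : G -> option Y).
Variables (par : Y -> Y) (dist : Y -> nat) (children : Y -> seq Y) (b n : nat).
Hypothesis home_inj : forall u v y, home u = Some y -> home v = Some y -> u = v.
Hypothesis par_dist : forall y, par y != y -> dist (par y) < dist y.
Hypothesis par_children : forall y, par y != y -> y \in children (par y).
Hypothesis size_children : forall y, size (children y) <= b.

Definition housed (Z : {set Y}) : {set G} :=
  [set v in D | if home v is Some y then y \in Z else false].

Definition subtree (y : Y) : {set Y} := [set z | fconnect par z y].

Hypothesis subtree_sep :
  forall y, exists2 s, size s <= n & separates D s (housed (subtree y)).
Hypothesis root_sep : forall y, par y = y -> separates D [::] (housed (subtree y)).
Hypothesis homeless : forall u v, home u = None -> edge G u v = false.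

Lemma housedU Z Z' : housed (Z :|: Z') = housed Z :|: housed Z'.
Proof.
apply/setP=> v; rewrite !inE -andb_orr; congr (_ && _).
by case: (home v) => // y; rewrite inE.
Qed.

Lemma housed_disjoint (Z Z' : {set Y}) : [disjoint Z & Z'] -> [disjoint housed Z & housed Z'].
Proof.
move=> ZZ; rewrite -setI_eq0; apply/eqP/setP=> v; rewrite !inE.
case: (home v) => [y|]; last by rewrite !andbF.
by case: (boolP (y \in Z)) => [/(disjointFr ZZ)->|_]; rewrite ?andbF.
Qed.

Lemma housed1 y : housed [set y] = set0 \/ exists v, housed [set y] = [set v].
Proof.
have [->|[v]] := set_0Vmem (housed [set y]); first by left.
rewrite inE => /andP[vD]; case hv: (home v) => [z|//]; rewrite inE => /eqP zy.
right; exists v; apply/setP => u; rewrite !inE; apply/andP/eqP => [[_]|->].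
  by case hu: (home u) => [x|//]; rewrite inE => /eqP xy; apply: home_inj hu _; rewrite hv zy xy.
by rewrite vD hv zy inE.
Qed.

Lemma fconnect_dist z y : fconnect par z y -> dist y <= dist z.
Proof.
move=> /iter_findex <-; elim: (findex _ z y) => //= k IH; apply: leq_trans IH.
by have [->//|/par_dist/ltnW] := eqVneq (par (iter k par z)) (iter k par z).
Qed.

Lemma fconnect_comparable z c c' : fconnect par z c -> fconnect par z c' ->
  fconnect par c c' \/ fconnect par c' c.
Proof.
move=> /iter_findex <- /iter_findex <-.
move: (findex _ _ _) (findex _ _ _) => i j.
have [le|/ltnW le] := leqP i j; [right|left].
  by rewrite -(subnK le) iterD fconnect_iter.
by rewrite -(subnK le) iterD fconnect_iter.
Qed.

Lemma fconnect_parE z y : fconnect par z y = (z == y) || fconnect par (par z) y.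
Proof.
apply/idP/orP => [/iter_findex|[/eqP->|]]; last exact: connect_trans (fconnect1 _ _).
  case: (findex _ _ _) => [/= ->|k]; first by left.
  by rewrite iterSr => <-; right; apply: fconnect_iter.
exact: connect0.
Qed.

Lemma sibling_disjoint y c c' : par c = y -> c != y -> par c' = y -> c' != y ->
  c != c' -> [disjoint subtree c & subtree c'].
Proof.
move=> pc cy pc' cy' cc'; rewrite -setI_eq0; apply/eqP/setP=> z; rewrite !inE.
apply/negP => /andP[zc zc'].
have no a a' : par a = y -> a != a' -> par a' = y -> a' != y -> ~~ fconnect par a a'.
  move=> pa aa' pa' ay'; rewrite fconnect_parE (negPf aa') /= pa.
  apply/negP => /fconnect_dist; rewrite leqNgt -[in dist y]pa' par_dist //.
  by rewrite pa' eq_sym.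
case: (fconnect_comparable zc zc'); apply/negP; first exact: no.
by apply: no => //; rewrite eq_sym.
Qed.

Definition tree_children (y : Y) : seq Y :=
  undup [seq c <- children y | (par c == y) && (c != y)].

Local Notation T := (sep_type (b * n).+1).

(** Child subtrees are merged into the node one at a time. Each intermediate set is cut off by the
    vertex housed at the node and the separators of at most b children, whence bn+1. *)
Lemma decomposable_subtree y : decomposable T D (housed (subtree y)).
Proof.
pose M := \max_z dist z; have leM z : dist z <= M by apply: leq_bigmax.
have [k] := ubnP (M - dist y); elim: k y => // k IH y ley.
have childP c : c \in tree_children y -> par c = y /\ c != y.
  by rewrite mem_undup mem_filter => /andP[/andP[/eqP]].
have dec_child c : c \in tree_children y -> decomposable T D (housed (subtree c)).
  move=> /childP[pc cy]; apply: IH.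
  have : dist y < dist c by rewrite -[in dist y]pc par_dist // pc eq_sym.
  by move: (leM c) ley; lia.
have sub_size : size (tree_children y) <= b.
  apply: leq_trans (size_undup _) _; rewrite size_filter.
  exact: leq_trans (count_size _ _) (size_children y).
have yE : subtree y = [set y] :|: \bigcup_(c <- tree_children y) subtree c.
  apply/setP => z; rewrite !inE; apply/idP/orP => [|[/eqP->|]]; last first.
  - rewrite bigcup_seq => /bigcupP[c /childP[pc _]]; rewrite inE => zc.
    by apply: connect_trans zc _; rewrite -pc fconnect1.
  - exact: connect0.
  move=> /iter_findex; elim: (findex _ _ _) => [/= ->|i IHi /=]; first by left.
  move=> e; have [e'|ne] := eqVneq (iter i par z) y; first exact: IHi.
  right; rewrite bigcup_seq; apply/bigcupP; exists (iter i par z).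
    rewrite mem_undup mem_filter e eqxx ne -[in children y]e par_children //.
    by rewrite e eq_sym.
  by rewrite inE fconnect_iter.
suff: decomposable T D (housed ([set y] :|: \bigcup_(c <- tree_children y) subtree c)).
  by rewrite -yE.
have : uniq (tree_children y) by apply: undup_uniq.
have : {subset tree_children y <= tree_children y} by [].
suff H (l : seq Y) : {subset l <= tree_children y} -> uniq l -> size l <= b ->
    decomposable T D (housed ([set y] :|: \bigcup_(c <- l) subtree c))
    /\ exists2 s, size s <= (size l * n).+1 &
      separates D s (housed ([set y] :|: \bigcup_(c <- l) subtree c)).
  by move=> sub un; have [] := H _ sub un sub_size.
elim: l => [_ _ _|c l IHl sub /= /andP[cl ul] lb].
  rewrite big_nil setU0; case: (housed1 y) => [->|[v ->]].
    by split; [exact: decomposable0|exists [::] => // u v; rewrite inE].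
  have sv : separates D [:: v] [set v] by move=> u w; rewrite inE mem_seq1 => ->.
  by split; [apply: decomposable1; apply: separates_width sv|exists [:: v]].
have [|||dec_l [s ss sl]] := IHl; [|by []|exact: ltnW|].
  by move=> a al; apply: sub; rewrite inE al orbT.
have [s' ss' sc] := subtree_sep c.
have cy : c \in tree_children y by apply: sub; apply: mem_head.
have E : housed ([set y] :|: \bigcup_(a <- c :: l) subtree a) =
    housed (subtree c) :|: housed ([set y] :|: \bigcup_(a <- l) subtree a).
  by rewrite -housedU big_cons setUCA.
rewrite E; have sU := separatesU sc sl.
have sz : size (s' ++ s) <= ((size l).+1 * n).+1.
  by rewrite size_cat mulSn -addnS leq_add.
split; last by exists (s' ++ s).
have [pc cny] := childP c cy.
apply: decomposableU => //; first exact: dec_child.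
  apply: housed_disjoint; rewrite -setI_eq0 setIUr setU_eq0; apply/andP; split.
    apply/eqP/setP => z; rewrite !inE; apply/negP => /andP[+ /eqP zy].
    by rewrite zy => /fconnect_dist; rewrite leqNgt -[in dist y]pc par_dist // pc eq_sym.
  rewrite setIC bigcup_seq -setIC big_distrr /=.
  rewrite big1 // => a al; have [pa ay] := childP a (sub a (mem_behead (s := _ :: _) al)).
  apply/eqP; rewrite setI_eq0; apply: (sibling_disjoint (y := y)) => //.
  by apply: contraNneq cl => ->.
apply: separates_width sU; apply: leq_trans sz _.
by rewrite ltnS leq_mul2r lb orbT.
Qed.

(** Whole trees and homeless vertices have empty separators, so any number of them can be united at
    no cost. *)
Lemma decomposable_forest : decomposable T D D.
Proof.
pose rts := enum [pred y | par y == y].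
pose lone := enum [set v in D | home v == None].
pose parts := [seq housed (subtree y) | y <- rts] ++ [seq [set v] | v <- lone].
have sep0 A : A \in parts -> decomposable T D A /\ separates D [::] A.
  rewrite mem_cat => /orP[/mapP[y]|/mapP[v]].
    rewrite mem_enum inE => /eqP yr ->; split; first exact: decomposable_subtree.
    exact: root_sep.
  rewrite mem_enum inE => /andP[vD /eqP hv] ->.
  have sv : separates D [::] [set v].
    by move=> u w; rewrite inE => /eqP-> _; rewrite homeless.
  by split=> //; apply: decomposable1; apply: separates_width sv.
have root_of y : exists2 r, par r == r & fconnect par y r.
  have [k] := ubnP (dist y); elim: k y => // k IH y ley.
  have [py|npy] := eqVneq (par y) y; first by exists y; rewrite ?py.
  have [|r rr yr] := IH (par y); first by have := par_dist npy; lia.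
  by exists r => //; apply: connect_trans (fconnect1 _ _) yr.
have DE : D = \bigcup_(A <- parts) A.
  apply/setP => v; rewrite bigcup_seq; apply/idP/bigcupP => [vD|[A]].
    case hv: (home v) => [y|].
      have [r rr yr] := root_of y; exists (housed (subtree r)).
        rewrite mem_cat; apply/orP; left; apply/mapP; exists r => //.
        by rewrite mem_enum.
      by rewrite inE vD hv inE.
    exists [set v]; last by rewrite inE.
    rewrite mem_cat; apply/orP; right; apply/mapP; exists v => //.
    by rewrite mem_enum inE vD hv.
  rewrite mem_cat => /orP[/mapP[y _ ->]|/mapP[u]]; first by rewrite inE => /andP[].
  by rewrite mem_enum inE => /andP[uD _] ->; rewrite inE => /eqP->.
have disj A B x : A \in parts -> B \in parts -> x \in A -> x \in B -> A = B.
  have fix_ y z : par y == y -> fconnect par y z -> y = z.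
    by move=> /eqP py /iter_findex <-; elim: (findex _ _ _) => //= i <-.
  rewrite !mem_cat => /orP[/mapP[y]|/mapP[v]] + -> /orP[/mapP[z]|/mapP[u]] + ->;
    rewrite !mem_enum => + +.
  - rewrite !inE => py pz /andP[_ +] /andP[_].
    case: (home x) => // w; rewrite !inE => wy wz.
    by case: (fconnect_comparable wy wz) => /fix_ ->.
  - by rewrite !inE => py /andP[_ /eqP hu] /andP[_ +] /eqP xu; rewrite xu hu.
  - by rewrite !inE => /andP[_ /eqP hv] pz /eqP ->; rewrite hv andbF.
  - by rewrite !inE => _ _ /eqP-> /eqP->.
suff H l : {subset l <= parts} -> decomposable T D (\bigcup_(A <- l) A)
    /\ separates D [::] (\bigcup_(A <- l) A).
  by rewrite {2}DE; have [] := H parts.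
elim: l => [_|A l IH sub].
  by rewrite big_nil; split; [exact: decomposable0|move=> u v; rewrite inE].
have [dl sl] := IH (fun B Bl => sub B (mem_behead (s := _ :: _) Bl)).
have Ap : A \in parts by apply: sub; apply: mem_head.
have [dA sA] := sep0 A Ap; rewrite big_cons.
(* Several roots may house nothing, so the list of parts can contain the empty set repeatedly. *)
have [Al|Al] := boolP (A \in l).
  rewrite (setUidPr _) // bigcup_seq; exact: bigcup_sup.
have sU := separatesU sA sl; split=> //; apply: decomposableU => //; last first.
  exact: separates_width sU.
rewrite -setI_eq0; apply/eqP/setP => x; rewrite bigcup_seq !inE; apply/negP.
move=> /andP[xA /bigcupP[B Bl xB]]; case/negP: Al.
by rewrite (disj A B x) // sub // inE Bl orbT.
Qed.
End Forest.

(** * Decomposing boundedly many layers *)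

Section FlagTree.
Variables (G : graph) (S : embedding_scheme G) (lay : G -> nat) (par : G -> G).
Hypothesis par_root : forall x, (par x == x) = roots (edge G) x.
Hypothesis par_lay :
  forall x, par x != x -> edge G x (par x) /\ lay x = (lay (par x)).+1.
Variables (dist : flag G -> nat) (dpar : flag G -> flag G).
Hypothesis dpar_root : forall x, (dpar x == x) = roots (dual_rel S par) x.
Hypothesis dpar_dist :
  forall x, dpar x != x -> dual_rel S par x (dpar x) /\ dist x = (dist (dpar x)).+1.

Local Notation f := (face_step S).
Local Notation face := (face S).
Local Notation ent z := (entry S par dpar (face z)).
Local Notation flip0 := (flip0 S).
Local Notation flip1 := (flip1 S).

Let f_sym := fconnect_sym (@face_step_inj G S).

Lemma face_ent z : face (ent z) = face z.
Proof. by apply: (face_entry dpar_dist); apply: face_idem. Qed.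

(* Each face is traversed from its entry flag in the direction of [face_step];
   of the two flags at a side of an edge, [orient] is the one met. *)
Definition oriented (z : flag G) : bool := fconnect f (ent z) z.

Definition orient (z : flag G) : flag G := if oriented z then z else flip0 z.

Lemma oriented_flip0 z : oriented (flip0 z) = ~~ oriented z.
Proof.
rewrite /oriented face_flip0.
have := face_cover (face_ent z); case: (boolP (fconnect f (ent z) z)) => //= c _.
apply/negbTE/negP => c'; have := fconnect_flip0F S z.
by rewrite (connect_trans _ c') // f_sym.
Qed.

Lemma oriented_orient z : oriented (orient z).
Proof. by rewrite /orient; case: ifP => // h; rewrite oriented_flip0 h. Qed.

Lemma orient_id z : oriented z -> orient z = z.
Proof. by rewrite /orient => ->. Qed.

Lemma orient_flip0 z : orient (flip0 z) = orient z.
Proof. by rewrite /orient oriented_flip0; case: oriented; rewrite /= ?flip0K. Qed.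

Lemma face_orient z : face (orient z) = face z.
Proof. by rewrite /orient; case: ifP; rewrite ?face_flip0. Qed.

Lemma oriented_ent z : oriented (ent z).
Proof. by rewrite /oriented face_ent connect0. Qed.

Lemma oriented_face_step z : oriented (f z) = oriented z.
Proof. by rewrite /oriented face_step_face -same_fconnect1_r //; apply: face_step_inj. Qed.

Lemma face_finv z : face (finv f z) = face z.
Proof. by rewrite -[in RHS](f_finv (@face_step_inj G S) z) face_step_face. Qed.

Lemma oriented_finv z : oriented (finv f z) = oriented z.
Proof. by rewrite -[in RHS](f_finv (@face_step_inj G S) z) oriented_face_step. Qed.

Lemma flip0_finv z : flip0 (finv f z) = flip1 z.
Proof. by rewrite -[in RHS](f_finv (@face_step_inj G S) z) face_stepE flip1K. Qed.

(** The dual tree with every face unrolled: a flag hangs below its predecessor on the face walk, the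
    entry flag below the flag across its edge in the parent face, and an unoriented flag, as a leaf,
    below its partner. *)
Definition flag_par (z : flag G) : flag G :=
  if ~~ oriented z then flip0 z
  else if z != ent z then finv f z
  else if dpar (face z) == face z then z
  else orient (flip2 z).

(** The next flag of the walk, the unoriented partner, and the two flags through which a
    neighbouring face may be entered across the edge of [y]. *)
Definition flag_children (y : flag G) : seq (flag G) :=
  [:: f y; flip0 y; flip2 y; flip2 (flip0 y)].

(** A lexicographic rank: depth of the face in the dual tree, position on the face walk,
    orientation. *)
Definition flag_dist (z : flag G) : nat :=
  dist (face z) * #|{: flag G}|.*2.+1
  + (findex f (ent z) (orient z)).*2 + ~~ oriented z.

Lemma flag_parent_children z : flag_par z != z -> z \in flag_children (flag_par z).
Proof.
rewrite /flag_par /flag_children !inE; case: (boolP (oriented z)) => /= oz; last first.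
  by rewrite flip0K eqxx !orbT.
case: (z =P ent z) => /= _; last by rewrite (f_finv (@face_step_inj G S)) eqxx.
case: (dpar (face z) =P face z) => _; first by rewrite eqxx.
rewrite /orient; case: ifP => _ _; first by rewrite flip2K eqxx !orbT.
by rewrite flip0K flip2K eqxx !orbT.
Qed.

Lemma oriented_flag_par z : flag_par z != z -> oriented (flag_par z).
Proof.
rewrite /flag_par; case: (boolP (oriented z)) => /= oz; last by rewrite oriented_flip0.
case: (z =P ent z) => /= _; last by rewrite oriented_finv.
case: (dpar (face z) =P face z) => _; first by rewrite eqxx.
by rewrite oriented_orient.
Qed.

Lemma entry_dual z : dpar (face z) != face z ->
  ~~ tree_dart par (ent z).1 /\ face (flip2 (ent z)) = dpar (face z).
Proof. by move=> /(entryP dpar_dist)[]. Qed.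

Lemma findex_finv x z : fconnect f x z -> z != x -> findex f x (finv f z) < findex f x z.
Proof.
move=> xz zx; have := iter_findex xz; have := findex_max xz.
case: (findex f x z) => [_ /= e|k ltk /= e]; first by rewrite e eqxx in zx.
rewrite -e finv_f; last exact: face_step_inj.
by rewrite findex_iter // ltnW.
Qed.

Lemma flag_par_dist z : flag_par z != z -> flag_dist (flag_par z) < flag_dist z.
Proof.
rewrite /flag_par /flag_dist; case: (boolP (oriented z)) => /= oz; last first.
  by move=> _; rewrite face_flip0 orient_flip0 oriented_flip0 oz /=; lia.
case: (z =P ent z) => /= [ez|/eqP nez] //; last first.
  move=> _; rewrite face_finv oriented_finv oz !orient_id ?oriented_finv //.
  by have := findex_finv oz nez; lia.
case: (dpar (face z) =P face z) => [_|/eqP nd _]; first by rewrite eqxx.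
have [_ fe] := entry_dual nd; have [_ dE] := dpar_dist nd.
rewrite -ez in fe; rewrite oriented_orient face_orient fe dE orient_id ?oriented_orient //.
have lt : findex f (entry S par dpar (dpar (face z))) (orient (flip2 z)) < #|{: flag G}|.
  apply: leq_trans (findex_max _) (max_card _).
  by have := oriented_orient (flip2 z); rewrite /oriented face_orient fe.
have arith a b i j : i < b -> a * b.*2.+1 + i.*2 + 0 < a.+1 * b.*2.+1 + j.*2 + 0.
  by rewrite mulSn; lia.
exact: arith.
Qed.

Local Notation sub := (subtree flag_par).

Lemma flag_par_connectE z y : fconnect flag_par z y = (z == y) || fconnect flag_par (flag_par z) y.
Proof. exact: fconnect_parE. Qed.

Lemma subtree_orient y z : oriented y -> (orient z \in sub y) = (z \in sub y).
Proof.
move=> oy; rewrite !inE /orient; case: (boolP (oriented z)) => // oz.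
have pz : flag_par z = flip0 z by rewrite /flag_par oz.
rewrite [RHS]flag_par_connectE pz; case: (z =P y) => // zy.
by rewrite zy oy in oz.
Qed.

Lemma subtree_flip0 y z : oriented y -> (flip0 z \in sub y) = (z \in sub y).
Proof. by move=> oy; rewrite -(subtree_orient _ oy) orient_flip0 subtree_orient. Qed.

Lemma fconnect_ent z : oriented z -> fconnect flag_par z (ent z) /\
  forall y, fconnect flag_par z y -> fconnect flag_par (ent z) y \/ face y = face z.
Proof.
have [n] := ubnP (findex f (ent z) z); elim: n z => // n IH z lez oz.
have [e|ne] := eqVneq z (ent z).
  by rewrite -e; split=> [|y]; [exact: connect0|left].
have pz : flag_par z = finv f z by rewrite /flag_par oz ne.
have [||c1 c2] := IH (finv f z).
- by rewrite face_finv; have := findex_finv oz ne; lia.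
- by rewrite oriented_finv.
rewrite face_finv in c1 c2; split.
  by rewrite flag_par_connectE pz c1 orbT.
by move=> y; rewrite flag_par_connectE pz => /orP[/eqP<-|/c2 //]; right.
Qed.

(* The vertices at which links between flags may leave the subtree of [y]. *)
Definition boundary (y : flag G) : seq G :=
  [:: fsource y, ftarget y, fsource (ent y)
    & [seq source d | d <- enum [pred d | extra_dart S par dpar d]]].

(** A corner joins a flag to its predecessor on the face walk, up to [flip0]. This is a link of the
    forest, cut only at [y], except at the entry, where the walk closes up; that corner is cut only
    if [y] lies on this face. *)
Lemma subtree_flip1 y z : oriented y ->
  (flip1 z \in sub y) != (z \in sub y) -> fsource z \in boundary y.
Proof.
move=> oy.
have main x : oriented x -> (flip1 x \in sub y) != (x \in sub y) -> fsource x \in boundary y.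
  move=> ox; rewrite -flip0_finv subtree_flip0 //.
  have [e|ne] := eqVneq x (ent x); last first.
    have px : flag_par x = finv f x by rewrite /flag_par ox ne.
    rewrite !inE (flag_par_connectE x) px /=.
    by case: (x =P y) => [->|_]; rewrite /= eqxx.
  have [|c1 c2] := @fconnect_ent (finv f x); first by rewrite oriented_finv.
  rewrite face_finv -e in c1 c2.
  rewrite !inE; have [xy|xy] := boolP (fconnect flag_par x y).
    by rewrite (connect_trans c1 xy).
  case: (boolP (fconnect flag_par (finv f x) y)) => // /c2.
  rewrite (negPf xy) => -[//|fy] _.
  by rewrite fy -e eqxx !orbT.
case: (boolP (oriented z)) => oz; first exact: main.
move=> h; rewrite -(fsource_flip1 S z); apply: main.
  by rewrite -[z](flip0K S) -face_stepE oriented_face_step oriented_flip0.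
by rewrite flip1K eq_sym.
Qed.

(** The edge is either extra, with its source listed in [boundary], or dual to a link between two
    faces; that link is cut only when it leads from [y] to its parent. *)
Lemma subtree_flip2 y z : oriented y -> ~~ tree_dart par z.1 ->
  (flip2 z \in sub y) != (z \in sub y) -> fsource z \in boundary y.
Proof.
move=> oy nt; have [ez|] := boolP (extra_dart S par dpar z.1).
  move=> _; rewrite !inE (map_f (source (G := G))) ?orbT //.
  by rewrite mem_enum.
rewrite /extra_dart nt negbK => /existsP[x /andP[nx xz]].
have [e [ze fe ne oe e_ent]] : exists e : flag G, [/\ (z.1 == e.1) || (z.1 == dart_rev e.1),
    face e = x, dpar (face e) != face e, oriented e & e = ent e].
  have [_ fx _] := entryP dpar_dist nx; exists (entry S par dpar x).
  by rewrite fx; split=> //; have := oriented_ent x; rewrite -fx face_idem fx.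
have mem_e : (flip2 e \in sub y) != (e \in sub y) -> e = y.
  have pe : flag_par e = orient (flip2 e).
    by rewrite /flag_par oe -e_ent eqxx /= (negPf ne).
  rewrite -(subtree_orient (flip2 e) oy) [flip2]lock !inE -lock (flag_par_connectE e) pe.
  by have [->|_] := eqVneq e y; rewrite //= eqxx.
have side (u v : flag G) : u.1 = v.1 -> u = v \/ u = flip2 v.
  by case: u v => [d b] [d' b'] /= ->; case: b b' => [] []; [left|right|right|left].
have four : [\/ z = e, z = flip2 e, z = flip0 e | z = flip2 (flip0 e)].
  case/orP: ze => /eqP h; first by case: (side z e h) => ->; constructor.
  by case: (side z (flip0 e) h) => ->; constructor.
have key : (flip2 z \in sub y) != (z \in sub y) -> e = y.
  move=> h; apply: mem_e; move: h; case: four => ->.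
  - by [].
  - by rewrite flip2K eq_sym.
  - by rewrite -flip02 !(subtree_flip0 _ oy).
  - by rewrite flip2K -flip02 !(subtree_flip0 _ oy) eq_sym.
move=> /key ey; have [->|->] : fsource z = fsource y \/ fsource z = ftarget y.
- by rewrite -ey; case: four => ->; [left|left|right|right].
- exact: mem_head.
- by rewrite inE mem_head orbT.
Qed.

Definition home (v : G) : option (flag G) := [pick z : flag G | fsource z == v].

Lemma homeP v z : home v = Some z -> fsource z = v.
Proof. by rewrite /home; case: pickP => // w /eqP <- [<-]. Qed.

Variables (k : nat) (J : seq nat).
Hypothesis sizeJ : size J <= k.

(** Parents drop by exactly one layer, so an ancestor of x on layer j is reached in [lay x - j]
    steps. Layers above that of x yield x itself, which is harmless. *)
Definition ancestors (L : seq G) : seq G :=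
  [seq iter (lay x - j) par x | x <- L, j <- J].

Lemma fconnect_par_lay x u : fconnect par x u -> lay u <= lay x.
Proof.
move=> /iter_findex <-; elim: (findex _ x u) => //= n; apply: leq_trans.
have [->//|/par_lay[_ ->]] := eqVneq (par (iter n par x)) (iter n par x).
exact: leqnSn.
Qed.

Lemma ancestorsP L x u : x \in L -> fconnect par x u -> lay u \in J -> u \in ancestors L.
Proof.
move=> xL xu uJ; apply/allpairsP; exists (x, lay u); split=> //=.
move: xu => /iter_findex; move: (findex _ _ _) => n.
elim: n x {xL} => [x /= ->|n IH x]; first by rewrite subnn.
rewrite iterSr => e; have [px|npx] := eqVneq (par x) x.
  by apply: IH; rewrite -[in LHS]px.
have lu : lay u <= lay (par x).
  by apply: fconnect_par_lay; rewrite -e fconnect_iter.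
by have [_ ->] := par_lay npx; rewrite subSn // iterSr; apply: IH.
Qed.

Lemma size_ancestors L : size (ancestors L) <= size L * k.
Proof. by rewrite size_allpairs leq_mul2l sizeJ orbT. Qed.

Local Notation D := (layers lay J).

(** If x is on a layer of [J] and is no ancestor of a vertex of [L], nothing changes membership in
    [Z] along the contour below x, so all flags at x agree. Across an edge, [flip0] passes this on
    to the other end. *)
Lemma boundary_separates (Z : {set flag G}) L :
  (forall z, (flip0 z \in Z) = (z \in Z)) ->
  (forall z, (flip1 z \in Z) != (z \in Z) -> fsource z \in L) ->
  (forall z, ~~ tree_dart par z.1 -> (flip2 z \in Z) != (z \in Z) -> fsource z \in L) ->
  separates D (ancestors L) (housed D home Z).
Proof.
move=> Z0 Z1 Z2 u v uZ vZ e; apply: contraT; rewrite negb_or => /andP[uL vL].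
move: uZ vZ; rewrite !inE; case hu: (home u) => [z|]; last by rewrite andbF.
move=> /andP[uJ zZ] /andP[vZ vJ]; rewrite vJ /= in vZ.
have [w [wu wv]] := edge_flag e.
case hv: (home v) vZ => [z'|]; last first.
  move=> _; move: hv; rewrite /home; case: pickP => // /(_ (flip0 w)).
  by rewrite fsource_flip0 wv eqxx.
move=> z'Z.
have around x y y' : x \notin ancestors L -> lay x \in J -> fsource y = x -> fsource y' = x ->
    (y \in Z) = (y' \in Z).
  move=> xL xJ yx y'x; apply: (contour par_lay (v := x) Z0); rewrite ?yx ?y'x ?connect0 //.
    move=> t tx; apply/eqP; apply: contraNT xL => /Z1 tL; exact: ancestorsP tL tx xJ.
  move=> t tx nt; apply/eqP; apply: contraNT xL => /(Z2 _ nt) tL; exact: ancestorsP tL tx xJ.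
have wZ : w \in Z by rewrite (around u w z) // (homeP hu).
have : flip0 w \in Z by rewrite Z0.
by rewrite (around v _ z') ?(homeP hv) // (negPf z'Z).
Qed.

Lemma home_inj u v z : home u = Some z -> home v = Some z -> u = v.
Proof. by move=> /homeP <- /homeP <-. Qed.

Lemma homeless_edge u v : home u = None -> edge G u v = false.
Proof.
rewrite /home; case: pickP => // no _; apply/negP => /edge_flag[w [wu _]].
by have := no w; rewrite wu eqxx.
Qed.

(** [boundary] has at most 3 + (2g+1) entries, each with at most k ancestors in the layers. The
    successor leaves room for the single vertex used when [y] is not oriented. *)
Lemma subtree_separator g y : (scheme_euler_genus S <= g%:Z)%R ->
  exists2 s, size s <= ((g.*2 + 4) * k).+1 & separates D s (housed D home (sub y)).
Proof.
move=> genus; case: (boolP (oriented y)) => oy.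
  exists (ancestors (boundary y)).
    apply: leqW; apply: leq_trans (size_ancestors _) _; rewrite leq_mul2r; apply/orP; right.
    rewrite /= size_map -cardE; have := card_extra_darts par_root par_lay dpar_root dpar_dist genus.
    by rewrite cardsE => c; rewrite !addnS addn0 !ltnS.
  apply: boundary_separates => z; first exact: subtree_flip0.
    exact: subtree_flip1.
  exact: subtree_flip2.
(* Parents are oriented, so an unoriented flag is a leaf and houses at most its own source. *)
exists [:: fsource y] => // u v; rewrite inE => /andP[_].
case hu: (home u) => [z|//]; rewrite inE flag_par_connectE mem_seq1 => zy _ _.
suff -> : u = fsource y by rewrite eqxx.
rewrite -(homeP hu); case/orP: zy => [/eqP-> //|/iter_findex].
move: (findex _ _ _) => n; rewrite -iterSr => e; rewrite -e in oy *.
elim: n {e} oy => [|n IH] /=.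
  by have [->//|/oriented_flag_par->] := eqVneq (flag_par z) z.
set t := flag_par (iter n flag_par z) in IH *.
by have [e|/oriented_flag_par->//] := eqVneq (flag_par t) t; rewrite e.
Qed.

Let dc_sym : connect_sym (dual_rel S par) := sym_connect_sym (@dual_rel_sym G S par).

Lemma flag_root z :
  fconnect flag_par z (entry S par dpar (fingraph.root (dual_rel S par) (face z))).
Proof.
have [n] := ubnP (flag_dist z); elim: n z => // n IH z lez.
have [pz|npz] := eqVneq (flag_par z) z.
  move: pz; rewrite /flag_par; case: (boolP (oriented z)) => /= oz; last first.
    by move/eqP; rewrite (negPf (flip0_neq _ _)).
  case: (z =P ent z) => /= [ez|nez]; last first.
    move=> e; case: nez; have {}e : f z = z.
      by rewrite -[in LHS]e f_finv //; apply: face_step_inj.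
    move: oz; rewrite /oriented f_sym => /iter_findex <-.
    by elim: (findex _ _ _) => //= i <-.
  case: (dpar (face z) =P face z) => [d _|nd].
    have := dpar_root (face z); rewrite d eqxx => /esym/eqP->.
    by rewrite -ez connect0.
  have [nt fe] := entry_dual (introN eqP nd).
  move=> e; case: nd; rewrite -fe -ez -face_orient e //.
rewrite flag_par_connectE; apply/orP; right.
have -> : fingraph.root (dual_rel S par) (face z) =
    fingraph.root (dual_rel S par) (face (flag_par z)).
  rewrite /flag_par; case: (boolP (oriented z)) => /= oz; last by rewrite face_flip0.
  case: (z =P ent z) => /= [ez|nez]; last by rewrite face_finv.
  case: (dpar (face z) =P face z) => [//|/eqP nd].
  have [nt fe] := entry_dual nd; have [dr _] := dpar_dist nd.
  rewrite face_orient ez fe face_ent.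
  exact/(fingraph.rootP dc_sym)/connect1.
by apply: IH; apply: leq_trans (flag_par_dist npz) _.
Qed.

(** Flags at adjacent vertices lie on faces of one dual component by [contour_component], hence in
    one tree by [flag_root]. *)
Lemma root_separates y : flag_par y = y -> separates D [::] (housed D home (sub y)).
Proof.
move=> yr u v; rewrite !inE; case hu: (home u) => [z|]; last by rewrite andbF.
move=> /andP[uJ zy] /andP[+ vJ]; rewrite vJ /=; case hv: (home v) => [z'|]; last first.
  by move=> _; rewrite edge_sym homeless_edge.
rewrite !inE in zy * => /negP nz' e; case: nz'.
pose a z := fingraph.root (dual_rel S par) (face z).
have az : a z = a z'.
  apply: (contour_component par_root par_lay (S := S)) => [t|t|t nt|].
  - by rewrite /a face_flip0.
  - by rewrite /a face_flip1.
  - apply/esym/(fingraph.rootP dc_sym)/connect1/existsP; exists t.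
    by rewrite nt !eqxx.
  - rewrite (homeP hu) (homeP hv); apply/(fingraph.rootP _)/connect1 => //.
    exact: sym_connect_sym (@edge_sym G).
have fix_ t : fconnect flag_par y t -> t = y.
  by move=> /iter_findex <-; elim: (findex _ _ _) => //= i ->.
have := flag_root z'; rewrite -/(a z') -az.
have [/fix_->//|c zc] := fconnect_comparable zy (flag_root z).
exact: connect_trans zc c.
Qed.

Theorem decomposable_layers g : (scheme_euler_genus S <= g%:Z)%R ->
  decomposable (sep_type (4 * ((g.*2 + 4) * k).+1).+1) D D.
Proof.
move=> genus; apply: (decomposable_forest home_inj flag_par_dist
  flag_parent_children (b := 4)) => //.
- by move=> y; apply: subtree_separator.
- exact: root_separates.
- exact: homeless_edge.
Qed.
End FlagTree.

Definition decomposable_layering (g : nat) (G : graph) (lay : G -> nat) : Prop :=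
  forall k J, size J <= k ->
    decomposable (sep_type (4 * ((g.*2 + 4) * k).+1).+1) (layers lay J) (layers lay J).

Theorem bounded_genus_layering g G : euler_genus_at_most g G ->
  exists2 lay : G -> nat, layering lay & decomposable_layering g lay.
Proof.
move=> [S genus]; have [lay [par [par_root par_lay layS]]] := bfs_forest (@edge_sym G).
have [dist [dpar [dpar_root dpar_dist _]]] := bfs_forest (@dual_rel_sym G S par).
exists lay; first exact: layS.
move=> k J sJ; exact (decomposable_layers par_root par_lay dpar_root dpar_dist sJ genus).
Qed.

(** * Flipping away the long edges of an interpretation *)

Section Remainder.
Variables (m : nat) (psi : formula m 2) (q r : nat).
Hypothesis r_gt0 : 0 < r.
Hypothesis psi_interp : interpretation_formula psi.
Hypothesis psi_local : forall (G : graph) (col : coloring m G) (d : G -> G -> nat),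
  edge_metric d -> forall e e' : 2.-tuple G, local_ef col d q r (zip e e') ->
  sat col psi e = sat col psi e'.

(** The distance beyond which [local_ef_cat] glues the games on two single vertices. *)
Definition radius : nat := q.*2.+1 * r.

Definition vertex_type_set : finType :=
  game_type {set 'I_m} (bool * bool * 'I_r.+2)%type q 1.

Section Graph.
Variables (G : graph) (col : coloring m G) (lay : G -> nat).
Hypothesis layP : layering lay.
Local Notation d := (layer_dist lay).

Definition vertex_type (u : G) : vertex_type_set :=
  type_of (colors_of col) (local_rel d r) (@local_near r) q [tuple u].

(** By [far_sat], far pairs of given types all agree on [psi], so one witness decides. *)
Definition far_pattern (s t : vertex_type_set) : bool :=
  [exists u, exists v, [&& vertex_type u == s, vertex_type v == t,
                           radius < d u v & sat2 col psi u v]].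

Definition remainder_edge : rel G := fun u v =>
  (u != v) && (sat2 col psi u v (+) far_pattern (vertex_type u) (vertex_type v)).

Let dC u v : d u v = d v u. Proof. by rewrite /layer_dist addnC. Qed.

Lemma far_pattern_sym : symmetric far_pattern.
Proof.
suff sub s t : far_pattern s t -> far_pattern t s by move=> s t; apply/idP/idP; apply: sub.
move=> /existsP[u /existsP[v /and4P[su tv far e]]]; apply/existsP; exists v.
apply/existsP; exists u; rewrite su tv dC far /=.
by have [_ ->] := psi_interp col.
Qed.

Lemma remainder_edge_sym : symmetric remainder_edge.
Proof.
move=> u v; rewrite /remainder_edge eq_sym far_pattern_sym.
by have [_ ->] := psi_interp col.
Qed.

Lemma remainder_edge_irrefl : irreflexive remainder_edge.
Proof. by move=> u; rewrite /remainder_edge eqxx. Qed.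

Lemma far_sat u v u' v' : radius < d u v -> radius < d u' v' ->
  vertex_type u = vertex_type u' -> vertex_type v = vertex_type v' ->
  sat2 col psi u v = sat2 col psi u' v'.
Proof.
move=> far far' /type_of_ef eu /type_of_ef ev.
apply: (psi_local (layer_dist_metric layP)).
apply: (local_ef_cat (layer_dist_metric layP) (p1 := [:: (u, u')])) => //.
by move=> a b; rewrite !inE => /eqP-> /eqP->.
Qed.

Lemma remainder_edge_near u v : remainder_edge u v -> d u v <= radius.
Proof.
move=> /andP[_]; apply: contraLR; rewrite -ltnNge => far.
suff -> : far_pattern (vertex_type u) (vertex_type v) = sat2 col psi u v.
  by rewrite addbb.
apply/existsP/idP => [[u' /existsP[v' /and4P[/eqP eu /eqP ev far' e]]]|e].
  by rewrite -(far_sat far' far eu ev).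
by exists u; apply/existsP; exists v; rewrite !eqxx far.
Qed.

(** * Clique-width of windows of the remainder *)

Section Window.
Variables (k : nat) (J : seq nat) (T : finType).
Hypothesis sizeJ : size J <= k.

(** The first component decides the flipped pattern, the second the truth of [psi] across the
    cut. *)
Definition window_type : finType :=
  (vertex_type_set
   * game_type (side_color m k T) side_reltype q 1)%type.

Variables (W : graph) (h : W -> G).
Hypothesis h_inj : injective h.
Hypothesis h_deep : forall x, deep lay J r q (h x).
Hypothesis h_edge : forall x y, edge W x y = remainder_edge (h x) (h y).

Lemma window_width (A : {set G}) : A \subset layers lay J -> width_le T (layers lay J) A ->
  width_le window_type [set: W] (h @^-1: A).
Proof.
move=> AJ [c cP].
exists (fun x => (vertex_type (h x), side_type col lay k J A c q (h x))) => u v w.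
rewrite !inE => uA vA /andP[wA _] [et es].
have wD : h w \in layers lay J :\: A.
  by rewrite !inE wA /=; apply: (h_deep (x := w)); rewrite /layer_dist subnn.
rewrite !h_edge /remainder_edge et.
have ne x : h x \in A -> h x != h w by apply: contraTneq => ->.
rewrite !ne //=; congr (_ (+) _).
apply: (psi_local (layer_dist_metric layP)).
exact: (side_type_local sizeJ AJ cP uA vA wD (@h_deep u) (@h_deep w) es).
Qed.

Lemma decomposable_window A : decomposable T (layers lay J) A ->
  A \subset layers lay J -> decomposable window_type [set: W] (h @^-1: A).
Proof.
elim=> {A} [_|x wx xJ|A B _ IHA _ IHB AB wAB].
- by rewrite preimset0; apply: decomposable0.
- have := window_width xJ wx; have [->|[y]] := set_0Vmem (h @^-1: [set x]).
    by move=> _; apply: decomposable0.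
  rewrite !inE => /eqP yx.
  have -> : h @^-1: [set x] = [set y].
    by apply/setP => z; rewrite !inE -yx (inj_eq h_inj).
  exact: decomposable1.
- move=> ABJ; have wd := window_width ABJ wAB; rewrite preimsetU in wd *.
  move: ABJ; rewrite subUset => /andP[AJ BJ].
  apply: decomposableU => //; [exact: IHA|exact: IHB|].
  by rewrite -setI_eq0 -preimsetI (disjoint_setI0 AB) preimset0.
Qed.

Lemma window_cliquewidth :
  decomposable T (layers lay J) (layers lay J) ->
  cliquewidth_at_most #|{: 'I_3 * window_type}| W.
Proof.
move=> dec; apply: decomposable_cliquewidth.
have {2}-> : [set: W] = h @^-1: layers lay J.
  apply/setP => x; rewrite !inE; apply/esym/(h_deep (x := x)).
  by rewrite /layer_dist subnn.
by apply: decomposable_window.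
Qed.
End Window.
End Graph.

Variable g : nat.

(** An injection in place of an isomorphism absorbs the induced subgraph taken at the end of a
    transduction. *)
Definition is_remainder (H : graph) : Prop :=
  exists (G : graph) (lay : G -> nat) (col : coloring m G) (f : H -> G),
    [/\ layering lay, decomposable_layering g lay, injective f
      & forall x y, edge H x y = remainder_edge col lay (f x) (f y)].

Lemma is_remainder_iso H K : iso H K -> is_remainder H -> is_remainder K.
Proof.
move=> /iso_sym[i ib iE] [G [lay [col [f [layP dec fI fE]]]]].
exists G, lay, col, (f \o i); split=> //; first exact: inj_comp fI (bij_inj ib).
by move=> x y; rewrite -iE fE.
Qed.

Definition remainder_class : graph_class := GraphClass is_remainder_iso.

(** Each of the k slices is padded separately by qr layers on either side, as required by [deep]. *)
Definition window_layers (k : nat) : nat := k * (radius + (q * r).*2).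

Definition slice_bound (k : nat) : nat :=
  #|{: 'I_3 * window_type (window_layers k)
        (sep_type (4 * ((g.*2 + 4) * window_layers k).+1).+1)}|.

(* The slices are blocks of [radius] consecutive layers; empty ones are
   dropped, so a window of k consecutive slices need not be a block of
   consecutive layers. *)
Lemma remainder_slices : has_slice_decompositions remainder_class.
Proof.
exists slice_bound => H [G [lay [col [f [layP dec fI fE]]]]].
have rad0 : 0 < radius by rewrite muln_gt0 r_gt0.
pose slice_of x := lay (f x) %/ radius.
pose idx := [seq j <- iota 0 (\max_x slice_of x).+1 | [exists x, slice_of x == j]].
pose slice j := [set x | slice_of x == j].
have idxP j : reflect (exists x, slice_of x = j) (j \in idx).
  rewrite mem_filter mem_iota /= add0n ltnS.
  apply: (iffP andP) => [[/existsP[x /eqP e] _]|[x <-]]; first by exists x.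
  split; first by apply/existsP; exists x.
  exact: leq_bigmax.
have idx_sorted : sorted ltn idx by apply: sorted_filter (iota_ltn_sorted _ _); apply: ltn_trans.
have nthV i : i < size idx -> nth set0 [seq slice j | j <- idx] i = slice (nth 0 idx i).
  by move=> lt; rewrite (nth_map 0).
have inV i x : x \in nth set0 [seq slice j | j <- idx] i ->
    i < size idx /\ slice_of x = nth 0 idx i.
  have [lt|le] := ltnP i (size idx); first by rewrite nthV // inE => /eqP.
  by rewrite nth_default ?size_map // inE.
exists [seq slice j | j <- idx]; split.
- split.
    rewrite map_inj_in_uniq ?filter_uniq ?iota_uniq // => i j /idxP[x xi] _ /setP/(_ x).
    by rewrite !inE xi eqxx => /esym/eqP.
  apply/and3P; split.
  + apply/eqP/setP => x; rewrite inE; apply/bigcupP; exists (slice (slice_of x)).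
      by rewrite inE map_f //; apply/idxP; exists x.
    by rewrite inE.
  + apply/trivIsetP => A B; rewrite !inE => /mapP[i _ ->] /mapP[j _ ->] ij.
    rewrite -setI_eq0; apply/eqP/setP => x; rewrite !inE; apply/negP => /andP[/eqP xi /eqP xj].
    by rewrite -xi -xj eqxx in ij.
  + rewrite inE; apply/mapP => -[j /idxP[x xj] /setP/(_ x)].
    by rewrite !inE xj eqxx.
- move=> u v i j e /inV[lti ui] /inV[ltj vj].
  (* Remainder edges span at most [radius] layers, which is the height of one slice. *)
  have le1 (x y : H) : edge H x y -> slice_of x <= (slice_of y).+1.
    rewrite fE => /(remainder_edge_near layP); rewrite /layer_dist => le.
    have le' : lay (f x) <= lay (f y) + radius.
      by move: le; move: (lay (f x)) (lay (f y)) => *; lia.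
    apply: leq_trans (leq_div2r radius le') _.
    by rewrite divnDr ?dvdnn // divnn rad0 addn1.
  have step a b : a < size idx -> b < size idx -> nth 0 idx a <= (nth 0 idx b).+1 -> a <= b.+1.
    move=> la lb; apply: contraTT; rewrite -!ltnNge => ba.
    have mono := sorted_ltn_nth ltn_trans 0 idx_sorted.
    have lb1 : b.+1 < size idx by apply: ltn_trans ba la.
    have := mono b b.+1 lb lb1 (ltnSn _); have := mono b.+1 a lb1 la ba.
    by rewrite /=; lia.
  split; apply: step => //; rewrite -ui -vj; apply: le1 => //.
  by rewrite edge_sym.
move=> k i _; rewrite -map_drop -map_take.
set js := take k (drop i idx).
have size_js : size js <= k by rewrite size_take_min geq_minl.
(* Each slice with its margins; truncated subtraction sends layers below the bottom to layer 0. *)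
pose J := [seq j * radius + t - q * r | j <- js, t <- iota 0 (radius + (q * r).*2)].
have sJ : size J <= window_layers k.
  by rewrite size_allpairs size_iota leq_mul2r size_js orbT.
pose h (x : induced (\bigcup_(A <- [seq slice j | j <- js]) A)) : G := f (val x).
apply: (window_cliquewidth layP sJ (h := h)).
- by move=> x y /fI/val_inj.
- move=> x y; rewrite /h; move: (val x) (valP x) => {}x + le.
  rewrite bigcup_seq => /bigcupP[A /mapP[j jjs ->]].
  rewrite inE => /eqP xj; apply/allpairsP; exists (j, lay y + q * r - j * radius).
  have := divn_eq (lay (f x)) radius; rewrite -/(slice_of x) xj.
  have := ltn_pmod (lay (f x)) rad0; move: le; rewrite /layer_dist.
  move: (j * radius) (q * r) (lay (f x)) (lay y) (_ %% _) => a b c e t.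
  by rewrite mem_iota /=; split=> //; lia.
- by move=> x y; rewrite -[LHS]/(edge H (val x) (val y)) fE.
- exact: dec.
Qed.
End Remainder.

Theorem theorem2 (C : graph_class) (T : transduction) (hC : bounded_genus C) :
  exists (D : graph_class) (k : nat),
    has_slice_decompositions D /\
    (forall H : graph, transduction_image T C H ->
      exists2 G : graph, D G & is_flip k G H).
Proof.
have [g genus] := hC; pose psi := tr_formula T.
have psi_interp : interpretation_formula psi by apply: tr_interp.
have [q [r [r0 psi_local]]] := gaifman psi.
exists (remainder_class psi q r g), #|{: vertex_type_set (num_colors T) q r}|.
split; first exact: remainder_slices.
move=> H [G /genus/bounded_genus_layering[lay layP dec] [col [A isoA]]].
pose edgeR (x y : {x : G | x \in A}) := remainder_edge psi q r col lay (val x) (val y).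
have edgeR_sym : symmetric edgeR by move=> x y; apply: remainder_edge_sym.
have edgeR_irrefl : irreflexive edgeR by move=> x; apply: remainder_edge_irrefl.
pose R := Graph edgeR_sym edgeR_irrefl.
exists R.
  exists G, lay, col, val; split=> //; exact: val_inj.
pose vt (x : R) := vertex_type q r col lay (val x).
pose block s := [set x : R | vt x == s].
pose P := [set block (vt x) | x : R].
have trivP : trivIset P.
  apply/trivIsetP => _ _ /imsetP[x _ ->] /imsetP[y _ ->] xy.
  rewrite -setI_eq0; apply/eqP/setP => z; rewrite !inE; apply/negP => /andP[/eqP zx /eqP zy].
  by rewrite -zx -zy eqxx in xy.
have blockP x : pblock P x = block (vt x).
  by apply: def_pblock => //; [apply: imset_f|rewrite inE].
have block_inj x y : block (vt x) = block (vt y) -> vt x = vt y.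
  by move=> /setP/(_ x); rewrite !inE eqxx => /esym/eqP.
pose pat := far_pattern psi (q := q) (r := r) col lay.
pose F := [set [set block (vt xy.1); block (vt xy.2)] | xy : R * R & pat (vt xy.1) (vt xy.2)].
exists P, F; split.
- apply/and3P; split=> //.
    apply/eqP/setP => x; rewrite inE; apply/bigcupP; exists (block (vt x)).
      exact: imset_f.
    by rewrite inE.
  by apply/imsetP => -[x _ /setP/(_ x)]; rewrite !inE eqxx.
- have -> : P = block @: [set vt x | x : R].
    by rewrite -imset_comp.
  exact: leq_trans (leq_imset_card _ _) (max_card _).
apply: iso_trans isoA _; exists id; first by exists id.
move=> x y; rewrite /= /flip_edge /= !blockP.
have pat_sym s t : pat s t = pat t s by apply: far_pattern_sym.
(* Distinct types have distinct blocks, so an unordered pair of blocks determines the types up to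
   order, and the pattern is symmetric. *)
have -> : ([set block (vt x); block (vt y)] \in F) = pat (vt x) (vt y).
  apply/imsetP/idP => [[[u v]]|pxy]; last by exists (x, y); rewrite ?inE.
  rewrite inE /= => puv /setP E; have pvu : pat (vt v) (vt u) by rewrite pat_sym.
  have key s t : (block (vt s) == block (vt t)) = (vt s == vt t).
    by apply/eqP/eqP => [/block_inj|->].
  have := E (block (vt u)); have := E (block (vt v)).
  have := E (block (vt x)); have := E (block (vt y)).
  rewrite !inE !key !eqxx ?orbT /= => /esym/orP[]/eqP e1 /esym/orP[]/eqP e2;
    rewrite e1 e2 // => /orP[]/eqP e3 /orP[]/eqP e4; congruence.
(* The pattern is added twice to the truth value of [psi] and cancels. *)
rewrite /edgeR /remainder_edge.
have [<-|xy] := eqVneq x y; first exact/esym/(induced_edge_irrefl x).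
by rewrite (inj_eq val_inj) xy /= addbK.
Qed.
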